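(* Assume that $\sum_{k\geqslant 1} k^2 q_k<\infty$. For any $\varphi\in C_b(\mathbb{R}^d)$, $\varphi\geqslant 0$, the weighted occupation time process $Y_t$ satisfies $$\lim _{t\rightarrow\infty}\mathbb{E}^\mu [\exp(-Y_t(\varphi))] =0,$$ and, for $\alpha<\big(\sum _{k\geqslant 1}(k-1)q_k\big)^{-1}$, $$\lim _{T\rightarrow \infty} \mathbb{E}^\mu \Big[ \exp \Big(- \frac {Y_T(\varphi)}{\exp(T/\alpha)}\Big)\Big]=1.$$
   Context: $d\geqslant1$ is an integer. $(q_k)_{k\geqslant 1}$ is a sequence of nonnegative numbers with $\sum_{k\geqslant 1}q_k=1$ and $1<\sum_{k\geqslant 1}kq_k<\infty$. $C_b(\mathbb{R}^d)$ is the set of bounded continuous functions on $\mathbb{R}^d$. $\widehat{\mathbb{R}^d}$ is the space of finite configurations: all finite sums of Dirac measures $\sum_{1\leqslant k\leqslant k_0}\delta_{x_k}$, $k_0\geqslant 1$, $x_k\in\mathbb{R}^d$, together with the zero measure $\mathbf{0}$, identified with the disjoint union over $m\geqslant0$ of the symmetric powers $(\mathbb{R}^d)^{(m)}$, with the disjoint-union topology and its Borel $\sigma$-algebra. For Borel $\psi\geqslant0$ on $\mathbb{R}^d$ set $\widehat\psi(\sum_k\delta_{x_k})=\prod_k\psi(x_k)$, $\widehat\psi(\mathbf{0})=1$. $\widehat X=(\widehat X_t)_{t\geqslant0}$ is the branching process on $\widehat{\mathbb{R}^d}$ (a Markov process such that, for all $\mu_1,\mu_2\in\widehat{\mathbb{R}^d}$,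 the process started from $\mu_1+\mu_2$ is equal in distribution to the sum of independent copies started from $\mu_1$ and from $\mu_2$) whose transition function $(\mathbf{H}_t)_{t\geqslant 0}$ satisfies $\mathbf{H}_t\widehat\psi=\widehat{u(\cdot,t)}$ for all Borel $\psi$ with $0\leqslant\psi\leqslant1$, where $u$ is the unique global mild solution with values in $[0,1]$ of $u_t=\Delta u-u+\sum_{k\geqslant1}q_ku^k$, $u(\cdot,0)=\psi$. $\mathbb{E}^\mu$ is the expectation for $\widehat X$ started at $\mu\in\widehat{\mathbb{R}^d}$. The weighted occupation time process is $Y_t(\varphi)=\int_0^t\langle\varphi,\widehat X_s\rangle\,ds$, $t\geqslant0$, where $\langle\varphi,\nu\rangle=\int\varphi\,d\nu$; it is a.s. real-valued.
   Formalization: The first limit is stated for φ not identically zero and μ ≠ 0 (otherwise Y_t = 0 a.s. and the expectation is 1); the second is stated for 0 < α < (Σ(k−1)q_k)^{-1}, since T/α is undefined at α = 0 and the limit is 0 for α < 0 with φ and μ nonzero. *)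

(* Defs.v *)
From HB Require Import structures.
From mathcomp Require Import all_boot all_order all_algebra finmap multiset.
From mathcomp Require Import all_classical all_reals all_analysis.

Set Implicit Arguments.
Unset Strict Implicit.
Unset Printing Implicit Defensive.

Import Order.TTheory GRing.Theory Num.Theory.
Import numFieldNormedType.Exports.

Local Open Scope classical_set_scope.
Local Open Scope ring_scope.

Definition borel (T : ptopologicalType) := g_sigma_algebraType (@open T).
HB.instance Definition _ (T : ptopologicalType) :=
  Measurable.copy (borel T) (g_sigma_algebraType (@open T)).

(* A finite sum of Dirac masses is the finite multiset of its atoms; the zero
   measure is [mset0], and the sum of measures is [msetD]. *)
Definition config (R : realType) (d : nat) := {mset 'rV[R]_d}%mset.

Section config_topology.
Context (R : realType) (d : nat).
Local Notation config := (config R d).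

HB.instance Definition _ := Choice.on config.
HB.instance Definition _ := isPointed.Build config mset0.

(* (R^d)^m is represented by the m x d matrices, the i-th point being the
   i-th row. *)
Definition config_of (m : nat) (x : 'M[R]_(m, d)) : config :=
  seq_mset [seq row i x | i <- enum 'I_m].

(* Disjoint union over m of the quotient topologies of (R^d)^m -> (R^d)^(m). *)
Definition config_open (U : set config) :=
  forall m, open (@config_of m @^-1` U).

Let config_openT : config_open setT.
Proof. by move=> m; rewrite preimage_setT; exact: openT. Qed.

Let config_openI (A B : set config) :
  config_open A -> config_open B -> config_open (A `&` B).
Proof. by move=> oA oB m; rewrite preimage_setI; exact: openI. Qed.

Let config_open_bigU (I : Type) (f : I -> set config) :
  (forall i, config_open (f i)) -> config_open (\bigcup_i f i).
Proof.
by move=> of_ m; rewrite preimage_bigcup; apply: bigcup_open => i _; exact: of_.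
Qed.

HB.instance Definition _ := isOpenTopological.Build config
  config_openT config_openI config_open_bigU.

End config_topology.

Section branching.
Context (R : realType) (d : nat).
Local Notation rV := 'rV[R]_d.
Local Notation config := (config R d).
Local Notation configB := (borel config).

Definition hat (psi : rV -> R) (nu : config) : R :=
  \prod_(x <- enum_mset nu) psi x.

Definition pairing (phi : rV -> R) (nu : config) : R :=
  \sum_(x <- enum_mset nu) phi x.

(* E[f(Z)] for Z a standard Gaussian vector of R^n, as an iterated integral. *)
Fixpoint gauss_mean (n : nat) : ('rV[R]_n -> R) -> R :=
  match n with
  | 0 => fun f => f 0
  | n'.+1 => fun f => \int[normal_prob (0 : R) 1]_z
      gauss_mean (fun v : 'rV[R]_n' => f (row_mx (z%:M : 'rV[R]_1) v))
  end.

(* The semigroup generated by the Laplacian (not by half of it): the variance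
   of each coordinate at time t is 2t. *)
Definition heat (t : R) (f : rV -> R) (x : rV) : R :=
  gauss_mean (fun z : rV => f (x + Num.sqrt (2 * t) *: z)).

Definition reaction (q : nat -> R) (r : R) : R :=
  - r + fine (\sum_(1 <= k <oo) (q k * r ^+ k)%:E)%E.

(* [u t x] stands for u(x, t); only t >= 0 matters. *)
Record mild_solution (q : nat -> R) (psi : rV -> R) (u : R -> rV -> R) : Prop :=
  MildSolution {
    mild_measurable :
      measurable_fun [set p : measurableTypeR R * borel rV | 0 <= p.1]
        (fun p => u p.1 p.2);
    mild_range : forall t x, 0 <= t -> 0 <= u t x <= 1;
    mild_eq : forall t x, 0 <= t ->
      u t x = heat t psi x
        + \int[lebesgue_measure]_(s in `[0, t])
            heat (t - s) (fun y => reaction q (u s y)) x }.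

Record transition_function (H : R -> R.-pker configB ~> configB) : Prop :=
  TransitionFunction {
    transition0 : forall (nu : configB) (B : set configB), measurable B ->
      H 0 nu B = \d_nu B;
    transitionD : forall (s t : R) (nu : configB) (B : set configB),
      0 <= s -> 0 <= t -> measurable B ->
      H (s + t) nu B = (\int[H s nu]_eta H t eta B)%E }.

(* u is the unique global mild solution, with values in [0, 1], started
   from psi. *)
Definition branching_transition (q : nat -> R)
    (H : R -> R.-pker configB ~> configB) : Prop :=
  forall psi : rV -> R,
    measurable_fun [set: borel rV] (psi : borel rV -> R) ->
    (forall x, 0 <= psi x <= 1) ->
    exists u : R -> rV -> R,
      [/\ mild_solution q psi u,
          (forall v, mild_solution q psi v ->
             forall t x, 0 <= t -> v t x = u t x)
        & forall (t : R) (nu : configB), 0 <= t ->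
            (\int[H t nu]_eta (hat psi eta)%:E)%E = (hat (u t) nu)%:E].

Section process.
Context {dO : measure_display} {Omega : measurableType dO}.
Variables (P : configB -> probability Omega R) (X : R -> Omega -> configB).

Definition natural_filtration (s : R) : set (set Omega) :=
  <<s [set E | exists r (B : set configB),
         [/\ 0 <= r <= s, measurable B & E = X r @^-1` B] ]>>.

(* [P mu] is the law of the process started at mu. Joint measurability in
   (t, omega) is the only path regularity that is required. *)
Record markov_process (H : R -> R.-pker configB ~> configB) : Prop :=
  MarkovProcess {
    markov_transition : transition_function H;
    markov_measurable :
      measurable_fun [set p : measurableTypeR R * Omega | 0 <= p.1]
        (fun p => X p.1 p.2);
    markov_start : forall mu, {ae P mu, forall w, X 0 w = mu};
    markov_property : forall mu (s t : R) (E : set Omega) (B : set configB),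
      0 <= s -> 0 <= t -> natural_filtration s E -> measurable B ->
      P mu (E `&` X (s + t) @^-1` B) = (\int[P mu]_(w in E) H t (X s w) B)%E }.

(* The process started at mu1 + mu2 has the finite-dimensional distributions
   of the sum of independent copies started at mu1 and at mu2. *)
Definition branching_property : Prop :=
  forall (mu1 mu2 : configB) (n : nat) (t : 'I_n -> R)
      (B : 'I_n -> set configB),
    (forall i, 0 <= t i) -> (forall i, measurable (B i)) ->
    P (msetD mu1 mu2) (\bigcap_i (X (t i) @^-1` B i)) =
    (P mu1 \x P mu2)%E
      (\bigcap_i [set w | B i (msetD (X (t i) w.1) (X (t i) w.2))]).

Record branching_process (q : nat -> R)
    (H : R -> R.-pker configB ~> configB) : Prop := BranchingProcess {
  branching_markov : markov_process H;
  branching_sum : branching_property;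
  branching_kernel : branching_transition q H }.

Definition occupation (phi : rV -> R) (t : R) (w : Omega) : \bar R :=
  (\int[lebesgue_measure]_(s in `[0%R, t]) (pairing phi (X s w))%:E)%E.

End process.
End branching.

(* Main.v *)
Require Import Defs.
From HB Require Import structures.
From mathcomp Require Import all_boot all_order all_algebra finmap multiset.
From mathcomp Require Import all_classical all_reals all_analysis.
From mathcomp Require Import measurable_realfun.
From mathcomp Require Import lra ring.

Set Implicit Arguments.
Unset Strict Implicit.
Unset Printing Implicit Defensive.

Import Order.TTheory GRing.Theory Num.Theory.
Import numFieldNormedType.Exports.

Local Open Scope classical_set_scope.
Local Open Scope ring_scope.

(** Write [flow t psi x] for the mean of [hat psi] at time [t] when the process
starts from one particle at [x]; it is the mild solution [u] of the equation
started from [psi].  Both claims only involve the laws of the process at single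
times, hence this flow.

The kernels [H] make the flow a monotone semigroup: monotonicity is the
monotonicity of integrals ([le_flow]) and the semigroup property is the
Chapman-Kolmogorov equation ([flowD]).  The mild equation itself only serves to
compare the flow with the heat semigroup ([flow_le_heat]) and to measure the
effect of the reaction over short times.

First claim.  On a unit interval of times Jensen's inequality bounds
[exp (- Y_t)] by the mean over [s] of [exp (- <phi, X_s>)], so it suffices that
[flow s (exp (- phi)) x] tends to [0] for every [x]
([laplace_occupation_le]).  This is the hair trigger effect
([hair_trigger_effect]).  If [K >= 2] and [c = q K > 0], then the reaction term is
at most [- c r (1 - r)].  Under the heat flow a Gaussian bump [h] of large
variance [L] loses only a fraction [2 d t / L] of its height, so in a short time [t]
the flow takes [1 - a h] below [1 - (1 + c t / 8) a h] as long as [a <= 1/2]: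
the level [a] grows geometrically up to [1/2] and never falls below it again.  The heat
flow at time [L] puts some [a h] with [a > 0] below the image of [1 - exp (- phi)],
so [1/2 h] is reached for every large [L].  The flow of the constant [1/2] decays
geometrically to [0], and for a fixed time the flow of [1 - h / 2] at the
centre of [h] tends to that of [1/2] as [L] grows, by dominated convergence.

Second claim.  Let [b] be the sum of the [(k - 1) q k].  The reaction term is at
least [- b (1 - r)], so Gronwall's argument gives
[1 - flow t (1 - th) <= th exp (b' t)] for every [b' > b]
([flow_cst_growth]).  Letting [th] tend to [0], the mean of [<phi, X_t>] is at
most [|mu| M exp (b' t)], where [M] bounds [phi] ([mean_pairing_le]).  With
[b < b' < 1 / alpha] the mean of [Y_T / exp (T / alpha)] tends to [0], and
[1 - exp (- y) <= y]. *)

(** * Integrals of functions not known to be measurable *)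

Section unmeasured_integrals.
Context {dT : measure_display} {T : measurableType dT} {R : realType}.
Variable mu : {measure set T -> \bar R}.
Implicit Types (D : set T).

(** The integral of a nonnegative function is a supremum over the simple
functions below it, hence monotone for arbitrary functions.  The heat semigroup
is an iterated integral, and the monotonicity below spares a proof that every
partial integral is measurable in the remaining variables. *)
Lemma ge0_le_integral_unmeasured D (f g : T -> \bar R) :
    (forall x, D x -> 0 <= f x)%E -> (forall x, D x -> f x <= g x)%E ->
  (\int[mu]_(x in D) f x <= \int[mu]_(x in D) g x)%E.
Proof.
move=> f0 fg.
have g0 x : D x -> (0 <= g x)%E by move=> Dx; exact: le_trans (f0 _ Dx) (fg _ Dx).
rewrite !ge0_integralE//; apply: ereal_sup_le => _ [h hf <-]; exists h => // x.
by apply: le_trans (hf x) _; apply: lee_restrict.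
Qed.

Lemma integral_bounded_fin_num D (f : T -> R) (M : R) : measurable D ->
    (mu D < +oo)%E -> (forall x, D x -> 0 <= f x <= M) ->
  (\int[mu]_(x in D) (f x)%:E \is a fin_num)%E.
Proof.
move=> mD muD fM; rewrite ge0_fin_numE; last first.
  by apply: integral_ge0 => x /fM/andP[]; rewrite lee_fin.
apply: (@le_lt_trans _ _ (\int[mu]_(x in D) M%:E)%E).
  by apply: ge0_le_integral_unmeasured => x /fM/andP[]; rewrite ?lee_fin.
rewrite integral_cst//.
by rewrite -(@fineK _ (mu D)) ?ge0_fin_numE// -EFinM ltry.
Qed.

Lemma le_Rintegral_bounded D (f g : T -> R) (M : R) : measurable D ->
    (mu D < +oo)%E ->
    (forall x, D x -> `|f x| <= M) -> (forall x, D x -> `|g x| <= M) ->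
    (forall x, D x -> f x <= g x) ->
  \int[mu]_(x in D) f x <= \int[mu]_(x in D) g x.
Proof.
move=> mD muD fM gM fg.
have pos (h : T -> R) : (fun x => (h x)%:E)^\+%E = (fun x => (Num.max (h x) 0)%:E).
  by apply/funext => x; rewrite funeposE EFin_max.
have neg (h : T -> R) :
    (fun x => (h x)%:E)^\-%E = (fun x => (Num.max (- h x) 0)%:E).
  by apply/funext => x; rewrite funenegE EFin_max.
have bnd (h : T -> R) : (forall x, D x -> `|h x| <= M) ->
    forall x, D x -> 0 <= Num.max (h x) 0 <= M.
  move=> hM x /hM; rewrite le_max lexx orbT ge_max /= => /[dup].
  by move=> /(le_trans (ler_norm _)) -> /(le_trans (normr_ge0 _)).
have bndN (h : T -> R) : (forall x, D x -> `|h x| <= M) ->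
    forall x, D x -> 0 <= Num.max (- h x) 0 <= M.
  by move=> hM; apply: (bnd (\- h)) => x /hM; rewrite normrN.
have intE (h : T -> R) : (forall x, D x -> `|h x| <= M) ->
    \int[mu]_(x in D) h x =
    \int[mu]_(x in D) Num.max (h x) 0 - \int[mu]_(x in D) Num.max (- h x) 0.
  move=> hM; rewrite /Rintegral integralE pos neg fineB //.
    exact: (integral_bounded_fin_num mD muD (bnd h hM)).
  exact: (integral_bounded_fin_num mD muD (bndN h hM)).
rewrite (intE f)// (intE g)//; apply: lerB; apply: fine_le.
- exact: (integral_bounded_fin_num mD muD (bnd f fM)).
- exact: (integral_bounded_fin_num mD muD (bnd g gM)).
- apply: ge0_le_integral_unmeasured => x Dx; rewrite lee_fin.
    by rewrite le_max lexx orbT.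
  by rewrite ge_max !le_max lexx orbT fg.
- exact: (integral_bounded_fin_num mD muD (bndN g gM)).
- exact: (integral_bounded_fin_num mD muD (bndN f fM)).
- apply: ge0_le_integral_unmeasured => x Dx; rewrite lee_fin.
    by rewrite le_max lexx orbT.
  by rewrite ge_max !le_max lexx orbT lerN2 fg.
Qed.

End unmeasured_integrals.

(** * The reaction term *)

Lemma bernoulli_ineq (R : realDomainType) (x : R) n : 0 <= 1 + x ->
  1 + n%:R * x <= (1 + x) ^+ n.
Proof.
move=> x1; elim: n => [|n IH]; first by rewrite mul0r addr0 expr0.
rewrite exprS; apply: le_trans (ler_wpM2l x1 IH).
have : 0 <= n%:R * (x * x) by rewrite mulr_ge0// -expr2 sqr_ge0.
by rewrite -natr1; lra.
Qed.

Section reaction_term.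
Context {R : realType}.
Implicit Types (a q : nat -> R) (r : R).

Lemma partial_sum_le_series a n : (forall k, (1 <= k)%N -> 0 <= a k) ->
    (\sum_(1 <= k <oo) (a k)%:E < +oo)%E ->
  \sum_(1 <= k < n) a k <= fine (\sum_(1 <= k <oo) (a k)%:E)%E.
Proof.
move=> a0 afin; rewrite -lee_fin fineK; last first.
  by rewrite ge0_fin_numE// nneseries_ge0// => k k1 _; rewrite lee_fin a0.
rewrite -sumEFin; apply: nneseries_lim_ge => k k1 _.
by rewrite lee_fin a0.
Qed.

Lemma series_le_of_partial_sums a M : (forall k, (1 <= k)%N -> 0 <= a k) ->
    (forall n, \sum_(1 <= k < n) a k <= M) ->
  (\sum_(1 <= k <oo) (a k)%:E <= M%:E)%E.
Proof.
move=> a0 aM; apply: lime_le.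
  by apply: is_cvg_nneseries => k k1 _; rewrite lee_fin a0.
by apply: nearW => n; rewrite sumEFin lee_fin.
Qed.

Lemma series_fine_ge0 a : (forall k, (1 <= k)%N -> 0 <= a k) ->
  0 <= fine (\sum_(1 <= k <oo) (a k)%:E)%E.
Proof.
by move=> a0; apply/fine_ge0/nneseries_ge0 => k k1 _; rewrite lee_fin a0.
Qed.

Variable q : nat -> R.
Hypothesis q_ge0 : forall k, (1 <= k)%N -> 0 <= q k.
Hypothesis q_sum : (\sum_(1 <= k <oo) (q k)%:E = 1)%E.

Lemma partial_sum_le1 n : \sum_(1 <= k < n) q k <= 1.
Proof.
by have := partial_sum_le_series n q_ge0; rewrite q_sum /= => ->//; exact: ltry.
Qed.

Lemma pgf_term_ge0 r k : 0 <= r -> (1 <= k)%N -> 0 <= q k * r ^+ k.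
Proof. by move=> r0 k1; rewrite mulr_ge0 ?exprn_ge0 ?q_ge0. Qed.

Lemma pgf_term_le r k : 0 <= r <= 1 -> (1 <= k)%N -> q k * r ^+ k <= q k * r.
Proof.
move=> /andP[r0 r1] k1; rewrite ler_wpM2l ?q_ge0//.
by rewrite -[leRHS]expr1 ler_wiXn2l.
Qed.

Lemma pgf_lty r : 0 <= r <= 1 -> (\sum_(1 <= k <oo) (q k * r ^+ k)%:E < +oo)%E.
Proof.
move=> r01; have /andP[r0 r1] := r01; apply: (@le_lt_trans _ _ 1%:E); last exact: ltry.
apply: series_le_of_partial_sums => [k|n]; first exact: pgf_term_ge0.
apply: le_trans (partial_sum_le1 n); apply: ler_sum_nat => k /andP[k1 _].
apply: le_trans (pgf_term_le r01 k1) _.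
by rewrite ler_piMr ?q_ge0.
Qed.

Lemma reaction_ge r : 0 <= r <= 1 -> - r <= reaction q r.
Proof.
move=> /andP[r0 r1]; rewrite /reaction lerDl; apply: series_fine_ge0 => k.
exact: pgf_term_ge0.
Qed.

(** Since [r ^+ k <= r] for all [k >= 1], every term of the generating function
may be replaced by [q k * r], except the term [K], where [r ^+ K <= r ^+ 2] is
kept: this bounds the reaction by a logistic term. *)
Lemma reaction_le_logistic K r : (2 <= K)%N -> 0 <= r <= 1 ->
  reaction q r <= - (q K * (r * (1 - r))).
Proof.
move=> K2 r01; have /andP[r0 r1] := r01.
rewrite /reaction addrC lerBlDr addrC -lee_fin fineK; last first.
  rewrite ge0_fin_numE ?pgf_lty// nneseries_ge0// => k k1 _.
  by rewrite lee_fin pgf_term_ge0.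
apply: series_le_of_partial_sums => [k|n]; first exact: pgf_term_ge0.
pose N := maxn n K.+1.
have le_nN : \sum_(1 <= k < n) q k * r ^+ k <= \sum_(1 <= k < N) q k * r ^+ k.
  case: n @N => [|n] N.
    by rewrite big_geq// big_nat sumr_ge0// => k /andP[k1 _]; rewrite pgf_term_ge0.
  rewrite [leRHS](big_cat_nat _ (n := n.+1))//= ?leq_maxl// lerDl big_nat.
  by apply: sumr_ge0 => k /andP[nk _]; rewrite pgf_term_ge0// (leq_ltn_trans _ nk).
apply: le_trans le_nN _.
have KN : K \in index_iota 1 N by rewrite mem_index_iota leq_maxr (ltnW K2).
have := ler_wpM2r r0 (partial_sum_le1 N); rewrite mul1r mulr_suml.
rewrite !(bigD1_seq K)//= ?iota_uniq//.
set A := \sum_(_ <- _ | _) _; set B := \sum_(_ <- _ | _) _ => AB.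
have BA : B <= A.
  rewrite /B /A big_seq_cond [leRHS]big_seq_cond; apply: ler_sum => k.
  by rewrite mem_index_iota => /andP[/andP[k1 _] _]; exact: pgf_term_le.
have rK : r ^+ K <= r ^+ 2 by apply: ler_wiXn2l.
have := ler_wpM2l (q_ge0 (ltnW K2)) rK; lra.
Qed.

Hypothesis q_mean_fin : (\sum_(1 <= k <oo) (k%:R * q k)%:E < +oo)%E.

Lemma excess_term_ge0 k : (1 <= k)%N -> 0 <= (k%:R - 1) * q k.
Proof. by move=> k1; rewrite mulr_ge0 ?q_ge0// subr_ge0 ler1n. Qed.

Lemma excess_lty : (\sum_(1 <= k <oo) ((k%:R - 1) * q k)%:E < +oo)%E.
Proof.
apply: (@le_lt_trans _ _ (fine (\sum_(1 <= k <oo) (k%:R * q k)%:E)%E)%:E); last first.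
  exact: ltry.
have mk0 k : (1 <= k)%N -> 0 <= k%:R * q k by move=> k1; rewrite mulr_ge0 ?q_ge0.
apply: series_le_of_partial_sums => [k|n]; first exact: excess_term_ge0.
apply: le_trans (partial_sum_le_series n mk0 q_mean_fin).
apply: ler_sum_nat => k /andP[k1 _]; rewrite mulrBl mul1r lerBlDr lerDl.
exact: q_ge0.
Qed.

(** Termwise Bernoulli's inequality [r - r ^+ k <= (k - 1) (1 - r)]: the slope of
the reaction at [1] is the mean number of additional particles at a branching. *)
Lemma reaction_ge_linear r : 0 <= r <= 1 ->
  - (fine (\sum_(1 <= k <oo) ((k%:R - 1) * q k)%:E)%E * (1 - r)) <= reaction q r.
Proof.
move=> r01; have /andP[r0 r1] := r01; rewrite /reaction.
set b := fine _; set g := fine _.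
suff : r <= g + b * (1 - r) by lra.
have s0 : 0 <= 1 - r by lra.
have g0 : 0 <= g by apply: series_fine_ge0 => k; exact: pgf_term_ge0.
have b0 : 0 <= b by apply: series_fine_ge0 => k; exact: excess_term_ge0.
have [->|rn0] := eqVneq r 0; first by rewrite subr0 mulr1 addr_ge0.
have rgt0 : 0 < r by rewrite lt_neqAle eq_sym rn0.
rewrite -[leLHS]mul1r -ler_pdivlMr// -lee_fin -[1%:E]q_sum.
apply: series_le_of_partial_sums => // n; rewrite ler_pdivlMr// mulr_suml.
apply: (@le_trans _ _ (\sum_(1 <= k < n) (q k * r ^+ k + (k%:R - 1) * q k * (1 - r)))).
  apply: ler_sum_nat => k /andP[k1 _].
  have /(ler_wpM2l (q_ge0 k1)) : r <= r ^+ k + (k%:R - 1) * (1 - r); last by lra.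
  case: k k1 => // k _; rewrite -natr1 addrK exprS.
  have bern : 1 - k%:R * (1 - r) <= r ^+ k.
    have := @bernoulli_ineq R (r - 1) k; rewrite addrC subrK => /(_ r0); lra.
  have rk1 : r ^+ k <= 1 by rewrite exprn_ile1.
  have : 0 <= (1 - r) * (1 - r ^+ k) by rewrite mulr_ge0// subr_ge0.
  lra.
rewrite big_split /= -mulr_suml lerD//.
  by apply: partial_sum_le_series => [k|]; [exact: pgf_term_ge0|exact: pgf_lty].
rewrite ler_wpM2r//; apply: partial_sum_le_series => [k|]; last exact: excess_lty.
exact: excess_term_ge0.
Qed.

End reaction_term.

(** * Gaussian means and the heat semigroup *)

Section normal_density_integral.
Context {R : realType}.

(** The Gaussian density agrees almost everywhere with the Radon-Nikodym
derivative, for which the change of measure in integrals is known. *)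
Lemma ge0_integral_normal_prob (m s : R) (f : R -> \bar R) :
    measurable_fun [set: R] f -> (forall x, 0 <= f x)%E ->
  (\int[normal_prob m s]_x f x =
   \int[lebesgue_measure]_x (f x * (normal_pdf m s x)%:E))%E.
Proof.
move=> mf f0.
have dom := normal_prob_dominates m s.
pose nu : {finite_measure set (measurableTypeR R) -> \bar R} := normal_prob m s.
pose la : {sigma_finite_measure set (measurableTypeR R) -> \bar R} :=
  lebesgue_measure.
rewrite -(@Radon_Nikodym_SigmaFinite.change_of_variables _ _ _ nu la dom f setT)//.
have mpdf : measurable_fun [set: R] (fun x => (normal_pdf m s x)%:E).
  by apply/measurable_EFinP; exact: measurable_normal_pdf.
have iRN := Radon_Nikodym_SigmaFinite.f_integrable dom.
apply: ae_eq_integral => //.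
- by apply: emeasurable_funM => //; exact: (measurable_int _ iRN).
- exact: emeasurable_funM.
- apply: ae_eqe_mul2l; apply: integral_ae_eq => // A _ mA.
  by rewrite -(Radon_Nikodym_SigmaFinite.f_integral dom mA).
Qed.

End normal_density_integral.

Section gaussian_mean.
Context {R : realType}.
Local Notation normal := (normal_prob (0 : R) 1).

Lemma normal_mean_cst (a : R) : \int[normal]_z a = a.
Proof.
have N1 : fine (normal setT) = 1 by rewrite probability_setT.
by rewrite Rintegral_cst// N1 mulr1.
Qed.

Lemma gauss_mean_bounded n (f : 'rV[R]_n -> R) (M : R) :
  (forall v, `|f v| <= M) -> `|gauss_mean f| <= M.
Proof.
elim: n f => [|n IH] f fM; first exact: fM.
have M0 : 0 <= M by apply: le_trans (fM 0).
have Ny : (normal setT < +oo)%E by rewrite probability_setT ltry.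
rewrite /=; set F := fun z : R => gauss_mean _.
have FM z : `|F z| <= M by apply: IH => v; exact: fM.
rewrite ler_norml -[in X in X && _](normal_mean_cst (- M)).
rewrite -[in X in _ && X](normal_mean_cst M).
have nM : `|M| <= M by rewrite ger0_norm.
have nNM : `|- M| <= M by rewrite normrN.
by apply/andP; split; apply: (@le_Rintegral_bounded _ _ _ _ _ _ _ M) => // x _;
  have := FM x; rewrite !ler_norml => /andP[h1 h2]; rewrite ?h1 ?h2.
Qed.

Lemma le_gauss_mean n (f g : 'rV[R]_n -> R) (M : R) :
    (forall v, `|f v| <= M) -> (forall v, `|g v| <= M) ->
    (forall v, f v <= g v) ->
  gauss_mean f <= gauss_mean g.
Proof.
elim: n f g => [|n IH] f g fM gM fg; first exact: fg.
have Ny : (normal setT < +oo)%E by rewrite probability_setT ltry.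
apply: (@le_Rintegral_bounded _ _ _ _ _ _ _ M) => // x _.
- exact: gauss_mean_bounded.
- exact: gauss_mean_bounded.
- by apply: IH => v; [exact: fM|exact: gM|exact: fg].
Qed.

Lemma integrable_normal_bounded (k : R -> R) (M : R) :
    measurable_fun [set: R] k -> (forall z, `|k z| <= M) ->
  normal.-integrable [set: R] (EFin \o k).
Proof.
move=> mk kM; apply: measurable_bounded_integrable => //.
  exact: le_lt_trans (probability_le1 normal measurableT) (ltry 1).
by exists M; split; [exact: num_real|move=> y /ltW My x _; exact: le_trans My].
Qed.

(** The only linearity of [gauss_mean] that is used: for affine functions of a
product of one-variable functions all partial integrals are explicit, so their
measurability is not an issue. *)
Lemma gauss_mean_affine_prod n (k : 'I_n -> R -> R) (a b : R) :
    (forall i, measurable_fun [set: R] (k i)) ->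
    (forall i z, 0 <= k i z <= 1) ->
  gauss_mean (fun v : 'rV[R]_n => a + b * \prod_i k i (v 0 i)) =
  a + b * \prod_i \int[normal]_z k i z.
Proof.
elim: n k a b => [|n IH] k a b mk k01 /=; first by rewrite !big_ord0.
pose C := \prod_(i < n) \int[normal]_z k (lift ord0 i) z.
transitivity (\int[normal]_z (a + (b * C) * k ord0 z)).
  apply: eq_Rintegral => z _.
  transitivity (a + (b * k ord0 z) * C); last by rewrite mulrAC.
  rewrite -IH//; congr gauss_mean; apply/funext => v.
  rewrite big_ord_recl -mulrA; congr (_ + _ * (_ * _)).
    congr (k _ _); rewrite (_ : ord0 = lshift n (0 : 'I_1)); last exact/val_inj.
    by rewrite (row_mxEl (z%:M : 'rV_1) v) mxE eqxx mulr1n.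
  apply: eq_bigr => i _; congr (k _ _).
  rewrite (_ : lift ord0 i = rshift 1 i); last exact/val_inj.
  exact: (row_mxEr (z%:M : 'rV_1) v).
have ik : normal.-integrable setT (EFin \o k ord0).
  apply: (@integrable_normal_bounded _ 1) => // z.
  by have /andP[k0 k1] := k01 ord0 z; rewrite ger0_norm.
rewrite RintegralD//; last 2 first.
- by apply: (@integrable_normal_bounded _ `|a|) => // z.
- rewrite (_ : _ \o _ = fun z => ((b * C)%:E * (k ord0 z)%:E)%E)//.
  exact: integrableZl.
rewrite RintegralZl// normal_mean_cst.
by rewrite big_ord_recl -/C mulrA mulrAC.
Qed.

Lemma gauss_mean_cst n (a : R) : gauss_mean (fun _ : 'rV[R]_n => a) = a.
Proof.
transitivity (gauss_mean (fun v : 'rV[R]_n => a + 0 * \prod_(i < n) (fun=> 0) (v 0 i))).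
  by congr gauss_mean; apply/funext => v; rewrite mul0r addr0.
rewrite (@gauss_mean_affine_prod n (fun _ _ => 0))// ?mul0r ?addr0// => i z.
by rewrite lexx ler01.
Qed.

End gaussian_mean.

Section heat_semigroup.
Context {R : realType} {d : nat}.
Local Notation normal := (normal_prob (0 : R) 1).
Implicit Types (f g : 'rV[R]_d -> R) (x : 'rV[R]_d).

Lemma heat_bounded t f x (M : R) : (forall y, `|f y| <= M) -> `|heat t f x| <= M.
Proof. by move=> fM; apply: gauss_mean_bounded. Qed.

Lemma le_heat t f g x (M : R) :
    (forall y, `|f y| <= M) -> (forall y, `|g y| <= M) ->
    (forall y, f y <= g y) ->
  heat t f x <= heat t g x.
Proof. by move=> fM gM fg; apply: (@le_gauss_mean _ _ _ _ M). Qed.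

Lemma heat_cst t (a : R) x : heat t (fun=> a) x = a.
Proof. exact: gauss_mean_cst. Qed.

Lemma heat_affine_prod t (k : 'I_d -> R -> R) (a b : R) x :
    (forall i, measurable_fun [set: R] (k i)) ->
    (forall i z, 0 <= k i z <= 1) ->
  heat t (fun y => a + b * \prod_i k i (y 0 i)) x =
  a + b * \prod_i \int[normal]_z k i (x 0 i + Num.sqrt (2 * t) * z).
Proof.
move=> mk k01; rewrite /heat.
pose k' i z := k i (x 0 i + Num.sqrt (2 * t) * z).
rewrite -(@gauss_mean_affine_prod _ _ k').
- congr gauss_mean; apply/funext => v; congr (_ + _ * _).
  by apply: eq_bigr => i _; rewrite !mxE.
- move=> i; apply: measurableT_comp => //.
  by apply: measurable_funD => //; apply: measurable_funM.
- by move=> i z; exact: k01.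
Qed.

End heat_semigroup.

(** * One-dimensional Gaussian bumps *)

Section gaussian_bump.
Context {R : realType}.
Local Notation normal := (normal_prob (0 : R) 1).

Definition bump1 (L c z : R) : R := expR (- ((z - c) ^+ 2 / (2 * L))).

Lemma bump1_ge0_le1 (L c z : R) : 0 < L -> 0 <= bump1 L c z <= 1.
Proof.
move=> L0; rewrite expR_ge0 -[leRHS]expR0 ler_expR oppr_le0.
by rewrite mulr_ge0 ?sqr_ge0// invr_ge0 mulr_ge0// ltW.
Qed.

Lemma continuous_bump1 (L c : R) : continuous (bump1 L c).
Proof.
move=> z; have cB : y - c @[y --> z] --> z - c.
  by apply: (@cvgB _ R^o) => //; exact: cvg_cst.
apply: (cvg_comp (fun y => - ((y - c) ^+ 2 / (2 * L))) expR); last first.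
  exact: continuous_expR.
apply: (@cvgN _ R^o); apply: cvgM; last exact: cvg_cst.
exact: (cvgM cB cB).
Qed.

Lemma measurable_bump1 (L c : R) :
  measurable_fun [set: R] (bump1 L c).
Proof.
apply: measurableT_comp => //; apply: measurableT_comp => //.
apply: measurable_funM => //; apply: measurable_funX; exact: measurable_funB.
Qed.

(** A bump of variance [L] averages to a bump of variance [V = L + s ^+ 2] and
height [r = Num.sqrt (L / V)], which is at least [L / V >= 1 - s ^+ 2 / L]; so
a wide bump is nearly reproduced by a Gaussian average. *)
Lemma normal_mean_bump1 (L c y s : R) : 0 < L ->
  (1 - s ^+ 2 / L) * bump1 L c y <= \int[normal]_z bump1 L c (y + s * z).
Proof.
move=> L0; set a := y - c; pose V := L + s ^+ 2.
have V0 : 0 < V by rewrite ltr_wpDr ?sqr_ge0.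
have LV0 : 0 < L / V by rewrite divr_gt0.
pose r := Num.sqrt (L / V); have r0 : 0 < r by rewrite sqrtr_gt0.
have r2 : r ^+ 2 = L / V by rewrite sqr_sqrtr// ltW.
pose m := - (a * s / V).
(* Completing the square: after the product of the two exponentials is
   normalized, [z] is Gaussian of mean [m] and variance [r ^+ 2]. *)
have key z : bump1 L c (y + s * z) * normal_pdf 0 1 z =
    r * expR (- (a ^+ 2 / (2 * V))) * normal_pdf m r z.
  rewrite !normal_pdfE ?oner_neq0 ?gt_eqF// /normal_peak /normal_fun /bump1.
  rewrite expr1n mul1r r2 subr0.
  have -> : y + s * z - c = a + s * z by rewrite /a; lra.
  have -> : Num.sqrt (L / V * pi *+ 2) = r * Num.sqrt (pi *+ 2).
    by rewrite -mulrnAr sqrtrM// ltW.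
  have p0 : Num.sqrt (pi *+ 2 : R) != 0.
    by rewrite gt_eqF// sqrtr_gt0 pmulrn_lgt0// pi_gt0.
  transitivity ((Num.sqrt (pi *+ 2))^-1 *
     (expR (- ((a + s * z) ^+ 2 / (2 * L))) * expR (- z ^+ 2 / (1 *+ 2)))).
    by rewrite mulrCA.
  transitivity ((Num.sqrt (pi *+ 2))^-1 *
     (expR (- (a ^+ 2 / (2 * V))) * expR (- (z - m) ^+ 2 / (L / V *+ 2)))).
    rewrite -!expRD; congr (_ * expR _); rewrite /m /V -[1 *+ 2]mulr_natr.
    rewrite -[_ *+ 2]mulr_natr; field.
    by rewrite /V in V0; rewrite !gt_eqF.
  rewrite invfM; field.
  by rewrite p0 gt_eqF.
have mk : measurable_fun [set: R] (fun z => bump1 L c (y + s * z)).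
  apply: measurableT_comp; first exact: measurable_bump1.
  by apply: measurable_funD => //; apply: measurable_funM.
have -> : \int[normal]_z bump1 L c (y + s * z) = r * expR (- (a ^+ 2 / (2 * V))).
  rewrite /Rintegral ge0_integral_normal_prob; last 2 first.
  - exact/measurable_EFinP.
  - by move=> z; rewrite lee_fin expR_ge0.
  under eq_integral do rewrite -EFinM key EFinM.
  rewrite ge0_integralZl//; last 3 first.
  - by apply/measurable_EFinP; exact: measurable_normal_pdf.
  - by move=> z _; rewrite lee_fin normal_pdf_ge0.
  - by rewrite lee_fin mulr_ge0 ?expR_ge0// ltW.
  by rewrite integral_normal_pdf mule1.
have LV : L <= V by rewrite lerDl sqr_ge0.
have r1 : r <= 1.
  by rewrite -sqrtr1 ler_wsqrtr// ler_pdivrMr// mul1r.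
have rLV : L / V <= r by rewrite -r2 expr2 ler_piMl// ltW.
have sr : 1 - s ^+ 2 / L <= r.
  apply: le_trans rLV; rewrite ler_pdivlMr// /V mulrBl mul1r.
  rewrite -subr_ge0 (_ : _ - _ = s ^+ 4 / L).
    by rewrite divr_ge0 ?exprn_even_ge0// ltW.
  by field; rewrite gt_eqF.
have [neg|pos] := leP (1 - s ^+ 2 / L) 0.
  apply: (@le_trans _ _ 0); first by rewrite mulr_le0_ge0 ?expR_ge0.
  by rewrite mulr_ge0 ?expR_ge0// ltW.
apply: ler_pM => //; [exact: ltW|exact: expR_ge0|].
rewrite ler_expR lerN2 ler_wpM2l ?sqr_ge0// lef_pV2 ?posrE ?mulr_gt0//.
by rewrite ler_pM2l.
Qed.

(** The mean is the Gaussian measure of an interval of length [2 * rho / s] whose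
points [z] satisfy [|z| s <= |y - c| + (|c - x0| + rho)], and
[(u + v) ^+ 2 <= 2 u ^+ 2 + 2 v ^+ 2] bounds the density from below there: a
bump appears. *)
Lemma normal_mean_interval (c x0 rho s : R) : 0 < s -> 0 < rho ->
  exists2 e : R, 0 < e & forall y,
    e * bump1 (s ^+ 2 / 2) c y <=
    \int[normal]_z \1_(`]x0 - rho, x0 + rho[ : set R) (y + s * z).
Proof.
move=> s0 rho0.
pose K := ((`|c - x0| + rho) ^+ 2) / s ^+ 2.
pose e := normal_peak 1 * expR (- K) * (2 * rho / s).
have pk0 : 0 < normal_peak 1 :> R by apply: normal_peak_gt0; exact: oner_neq0.
have rs0 : 0 < 2 * rho / s by apply: divr_gt0 => //; apply: mulr_gt0.
exists e; first by apply: mulr_gt0 => //; apply: mulr_gt0 => //; exact: expR_gt0.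
move=> y.
pose I : set R := `](x0 - rho - y) / s, (x0 + rho - y) / s[%classic.
have -> : \int[normal]_z \1_(`]x0 - rho, x0 + rho[ : set R) (y + s * z) =
    fine (normal I).
  rewrite -[in RHS](setIT I) -integral_indic//; last exact: measurable_itv.
  congr fine; apply: eq_integral => z _; congr EFin; congr (_%:R); congr nat_of_bool.
  apply/idP/idP; rewrite !inE /I /= !in_itv /= ltr_pdivrMr// ltr_pdivlMr//.
    by move=> /andP[? ?]; apply/andP; split; lra.
  by move=> /andP[? ?]; apply/andP; split; lra.
have muI : lebesgue_measure I = (2 * rho / s)%:E.
  rewrite /I lebesgue_measure_itv/= lte_fin ltr_pM2r ?invr_gt0//.
  have -> : x0 - rho - y < x0 + rho - y by lra.
  by rewrite -EFinB -mulrBl; congr (_ / _)%:E; lra.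
pose pmin := normal_peak 1 * expR (- K) * bump1 (s ^+ 2 / 2) c y.
have : (pmin%:E * lebesgue_measure I <= normal I)%E.
  rewrite -integral_cst//; last exact: measurable_itv.
  apply: ge0_le_integral_unmeasured => z.
    by rewrite lee_fin /pmin; rewrite !mulr_ge0 ?expR_ge0// ltW.
  rewrite /I /= in_itv /= ltr_pdivrMr// ltr_pdivlMr// => /andP[z1 z2].
  rewrite lee_fin normal_pdfE ?oner_neq0// /pmin -mulrA ler_wpM2l ?normal_peak_ge0//.
  rewrite /bump1 -expRD ler_expR subr0 expr1n.
  rewrite (_ : 2 * (s ^+ 2 / 2) = s ^+ 2); last by field.
  rewrite -opprD mulNr lerN2 /K -mulrDl ler_pdivlMr ?exprn_gt0// mulrAC.
  rewrite ler_pdivrMr ?pmulrn_lgt0// -exprMn.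
  set A := z * s; have : `|A| <= `|y - c| + (`|c - x0| + rho).
    rewrite /A ler_norml; have := ler_norm (y - c); have := ler_norm (c - x0).
    have := ler_normr (y-c) (- (y - c)); have := lerNnormlW (lexx `|c - x0|).
    have := lerNnormlW (lexx `|y - c|).
    by move=> ? ? _ ? ?; apply/andP; split; lra.
  move=> /(fun h => ler_pM (normr_ge0 _) (normr_ge0 _) h h).
  rewrite -expr2 real_normK ?num_real// => /le_trans; apply.
  rewrite -[1 *+ 2]/(2 : R) -[in leRHS](@real_normK _ (y - c)) ?num_real//.
  set p := `|y - c|; set r := _ + rho.
  have : 0 <= (p - r) * (p - r) by rewrite -expr2 sqr_ge0.
  lra.
rewrite muI -EFinM -(@fineK _ (normal I)) ?lee_fin.
  have -> : e * bump1 (s ^+ 2 / 2) c y = pmin * (2 * rho / s).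
    by rewrite /e /pmin; ring.
  by [].
apply: fin_num_measure; exact: measurable_itv.
Qed.

End gaussian_bump.

(** * Functionals of configurations *)

Section borel_functions.
Context {R : realType}.

Lemma borel_measurable_fun (T : ptopologicalType) (f : T -> R) :
    (forall A : set R, open A -> open (f @^-1` A)) ->
  measurable_fun [set: borel T] (f : borel T -> R).
Proof.
move=> fo; apply: (measurability _ (RGenOpens.measurableE R)).
move=> _ [_ [a [b ->] <-]]; rewrite setTI.
by apply: sub_sigma_algebra; apply: fo; exact: interval_open.
Qed.

Lemma continuous_borel_measurable (T : ptopologicalType) (f : T -> R) :
  continuous f -> measurable_fun [set: borel T] (f : borel T -> R).
Proof. by move=> /continuousP fc; apply: borel_measurable_fun. Qed.

Lemma continuous_sum_seq (T : topologicalType) (I : Type) (s : seq I)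
    (f : I -> T -> R) : (forall i, continuous (f i)) ->
  continuous (fun x => \sum_(i <- s) f i x).
Proof.
move=> fc x; elim: s => [|i s IH].
  under eq_fun do rewrite big_nil; exact: cvg_cst.
under eq_fun do rewrite big_cons.
by apply: cvgD; [exact: fc|exact: IH].
Qed.

Lemma cvg_prod_seq {T : Type} {F : set_system T} {FF : Filter F} (I : Type)
    (s : seq I) (f : I -> T -> R) (l : I -> R) : (forall i, f i @ F --> l i) ->
  \prod_(i <- s) f i x @[x --> F] --> \prod_(i <- s) l i.
Proof.
move=> fl; elim: s => [|i s IH].
  by under eq_fun do rewrite big_nil; rewrite big_nil; exact: cvg_cst.
under eq_fun do rewrite big_cons; rewrite big_cons.
by apply: cvgM; [exact: fl|exact: IH].
Qed.

Lemma continuous_prod_seq (T : topologicalType) (I : Type) (s : seq I)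
    (f : I -> T -> R) : (forall i, continuous (f i)) ->
  continuous (fun x => \prod_(i <- s) f i x).
Proof. by move=> fc x; apply: cvg_prod_seq => i; exact: fc. Qed.

Lemma continuous_expRN (T : topologicalType) (phi : T -> R) :
  continuous phi -> continuous (fun x => expR (- phi x)).
Proof.
move=> pc x; apply: (@continuous_comp _ _ _ phi (fun z : R => expR (- z))).
  exact: pc.
apply: (@continuous_comp _ _ _ (fun z : R => - z) expR); last exact: continuous_expR.
exact: (cvgN cvg_id).
Qed.

Lemma expRN_range (z : R) : 0 <= z -> 0 <= expR (- z) <= 1.
Proof. by move=> z0; rewrite expR_ge0 -[leRHS]expR0 ler_expR oppr_le0. Qed.

Lemma measurable_ge0_times d (T : measurableType d) :
  measurable [set p : measurableTypeR R * T | 0 <= p.1].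
Proof.
have m0 : measurable (`[0, +oo[%classic : set (measurableTypeR R)).
  exact: measurable_itv.
rewrite (_ : mkset _ = fst @^-1` (`[0, +oo[%classic : set (measurableTypeR R))).
  rewrite -[X in measurable X]setTI.
  exact: (@measurable_fst _ _ (measurableTypeR R) T measurableT _ m0).
by apply/seteqP; split => p; rewrite /= in_itv /= andbT.
Qed.

End borel_functions.

Section configurations.
Context {R : realType} {d : nat}.
Local Notation rV := 'rV[R]_d.
Local Notation config := (config R d).
Implicit Types (psi phi : rV -> R) (nu : config).

Lemma continuous_row m (i : 'I_m) : continuous (fun x : 'M[R]_(m, d) => row i x).
Proof.
move=> x A [P xP PA]; exists (fun j k => if j == i then P 0 k else setT).
  move=> j k; case: eqP => [->|_]; last exact: filterT.
  by have := xP 0 k; rewrite mxE.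
move=> y yP; apply: PA => j k; rewrite mxE ord1.
by have := yP i k; rewrite eqxx.
Qed.

Lemma hat_config_of m psi (x : 'M[R]_(m, d)) :
  hat psi (config_of x) = \prod_(i <- enum 'I_m) psi (row i x).
Proof. by rewrite /hat (perm_big _ (perm_eq_seq_mset _)) big_map. Qed.

Lemma pairing_config_of m phi (x : 'M[R]_(m, d)) :
  pairing phi (config_of x) = \sum_(i <- enum 'I_m) phi (row i x).
Proof. by rewrite /pairing (perm_big _ (perm_eq_seq_mset _)) big_map. Qed.

Lemma config_measurable_fun (F : config -> R) :
    (forall m, continuous (F \o @config_of R d m)) ->
  measurable_fun [set: borel config] (F : borel config -> R).
Proof.
move=> Fc; apply: borel_measurable_fun => A oA.
change (config_open (F @^-1` A)) => m.
by have /continuousP/(_ A oA) := Fc m.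
Qed.

Lemma measurable_hat psi : continuous psi ->
  measurable_fun [set: borel config] (hat psi : borel config -> R).
Proof.
move=> pc; apply: config_measurable_fun => m.
rewrite (_ : _ \o _ = fun x => \prod_(i <- enum 'I_m) psi (row i x)); last first.
  by apply/funext => x /=; rewrite hat_config_of.
apply: continuous_prod_seq => i x.
by apply: continuous_comp; [exact: continuous_row|exact: pc].
Qed.

Lemma measurable_pairing phi : continuous phi ->
  measurable_fun [set: borel config] (pairing phi : borel config -> R).
Proof.
move=> pc; apply: config_measurable_fun => m.
rewrite (_ : _ \o _ = fun x => \sum_(i <- enum 'I_m) phi (row i x)); last first.
  by apply/funext => x /=; rewrite pairing_config_of.
apply: continuous_sum_seq => i x.
by apply: continuous_comp; [exact: continuous_row|exact: pc].
Qed.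

Definition point_config (x : rV) : config := seq_mset [:: x].

Lemma hat_point psi x : hat psi (point_config x) = psi x.
Proof. by rewrite /hat (perm_big _ (perm_eq_seq_mset _)) big_seq1. Qed.

Lemma hat_ge0_le1 psi nu : (forall x, 0 <= psi x <= 1) -> 0 <= hat psi nu <= 1.
Proof.
move=> p01; apply/andP; split.
  by apply: prodr_ge0 => x _; have /andP[] := p01 x.
by apply: prodr_ile1 => x _; exact: p01.
Qed.

Lemma le_hat psi psi' nu : (forall x, 0 <= psi x <= psi' x) ->
  hat psi nu <= hat psi' nu.
Proof. by move=> pp; apply: ler_prod => x _; exact: pp. Qed.

Lemma hat_expRN phi nu :
  hat (fun x => expR (- phi x)) nu = expR (- pairing phi nu).
Proof. by rewrite /hat /pairing -sumrN expR_sum. Qed.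

Lemma pairing_ge0 phi nu : (forall x, 0 <= phi x) -> 0 <= pairing phi nu.
Proof. by move=> p0; apply: sumr_ge0. Qed.

End configurations.

(** * The nonlinear semigroup *)

Section nonlinear_flow.
Context {R : realType} {d : nat}.
Local Notation rV := 'rV[R]_d.
Local Notation configB := (borel (config R d)).
Variables (q : nat -> R) (H : R -> R.-pker configB ~> configB).
Implicit Types (psi : rV -> R) (x : rV) (s t : R) (nu : configB).

(** Borel measurability of [hat psi] is recorded separately: it holds for
continuous [psi], and the flow preserves it because [hat (flow t psi)] is an
integral against a kernel. *)
Record admissible psi : Prop := Admissible {
  admissible_measurable : measurable_fun [set: borel rV] (psi : borel rV -> R);
  admissible_range : forall x, 0 <= psi x <= 1;
  admissible_hat : measurable_fun [set: configB] (hat psi : configB -> R) }.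

Lemma continuous_admissible psi :
  continuous psi -> (forall x, 0 <= psi x <= 1) -> admissible psi.
Proof.
move=> pc p01; split=> //; first exact: continuous_borel_measurable.
exact: measurable_hat.
Qed.

(** Defining the solution through the transition kernel gives the comparison
principle and the semigroup property without any analysis of the equation. *)
Definition flow t psi x : R :=
  fine (\int[H t (point_config x)]_eta (hat psi eta)%:E)%E.

Hypothesis hT : transition_function H.
Hypothesis hB : branching_transition q H.

Lemma flow_mild_solution psi : admissible psi ->
  exists2 u, mild_solution q psi u & forall t, 0 <= t ->
    u t = flow t psi /\
    forall nu, (\int[H t nu]_eta (hat psi eta)%:E)%E = (hat (flow t psi) nu)%:E.
Proof.
move=> [mp p01 mh]; have [u [mu _ uH]] := hB mp p01; exists u => // t t0.
have E : u t = flow t psi.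
  by apply/funext => x; rewrite /flow uH//= hat_point.
by split=> // nu; rewrite uH// E.
Qed.

Lemma integral_hat psi t nu : admissible psi -> 0 <= t ->
  (\int[H t nu]_eta (hat psi eta)%:E)%E = (hat (flow t psi) nu)%:E.
Proof. by move=> /flow_mild_solution[u _ h] /h[_ ->]. Qed.

Lemma flow_range psi t x : admissible psi -> 0 <= t -> 0 <= flow t psi x <= 1.
Proof.
by move=> /flow_mild_solution[u mu h] t0; have [<- _] := h _ t0; exact: (mild_range mu).
Qed.

Lemma flow_mild psi t x : admissible psi -> 0 <= t ->
  flow t psi x = heat t psi x + \int[lebesgue_measure]_(s in `[0, t])
    heat (t - s) (fun y => reaction q (flow s psi y)) x.
Proof.
move=> /flow_mild_solution[u mu h] t0; have [<- _] := h _ t0.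
rewrite (mild_eq mu)//; congr (_ + _); apply: eq_Rintegral => s.
rewrite inE /= in_itv /= => /andP[s0 _]; have [E _] := h _ s0.
by rewrite E.
Qed.

Lemma flow_admissible psi t : admissible psi -> 0 <= t -> admissible (flow t psi).
Proof.
move=> ap t0; have [u mu h] := flow_mild_solution ap; have [E _] := h _ t0.
split; last 1 first.
- apply/measurable_EFinP.
  rewrite (_ : EFin \o _ = fun nu => (\int[H t nu]_eta (hat psi eta)%:E)%E).
    apply: (measurable_fun_integral_kernel (l := H t)) => [U mU|eta|].
    + exact: (measurable_kernel (H t) U mU).
    + by rewrite lee_fin; have /andP[] := hat_ge0_le1 eta (admissible_range ap).
    + by apply/measurable_EFinP; exact: admissible_hat.
  by apply/funext => nu /=; rewrite integral_hat.
- rewrite -E.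
  have mt : measurable_fun [set: borel rV]
      ((fun x => (t, x)) : borel rV -> measurableTypeR R * borel rV)%type.
    by apply: measurable_fun_pair => //.
  apply: (measurable_comp (@measurable_ge0_times R _ (borel rV)) _ (mild_measurable mu) mt).
  by move=> _ [x _ <-].
- by move=> x; exact: flow_range.
Qed.

Lemma integral_transitionD s t nu (f : configB -> \bar R) :
    0 <= s -> 0 <= t ->
    measurable_fun setT f -> (forall eta, 0 <= f eta)%E ->
  (\int[H (s + t) nu]_zeta f zeta =
   \int[H s nu]_eta \int[H t eta]_zeta f zeta)%E.
Proof.
move=> s0 t0 mf f0.
transitivity (\int[mkcomp (H s) (kernel.kernel_snd (H t)) nu]_zeta f zeta)%E.
  apply: eq_measure_integral => A mA _.
  by rewrite (transitionD hT).
exact: integral_kcomp.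
Qed.

Lemma flowD psi s t x : admissible psi -> 0 <= s -> 0 <= t ->
  flow (s + t) psi x = flow s (flow t psi) x.
Proof.
move=> ap s0 t0; rewrite /flow integral_transitionD//.
- by congr fine; apply: eq_integral => eta _; rewrite integral_hat.
- by apply/measurable_EFinP; exact: admissible_hat.
- by move=> eta; rewrite lee_fin; have /andP[] := hat_ge0_le1 eta (admissible_range ap).
Qed.

Lemma le_flow psi psi' t x : admissible psi -> admissible psi' -> 0 <= t ->
  (forall y, psi y <= psi' y) -> flow t psi x <= flow t psi' x.
Proof.
move=> ap ap' t0 pp; rewrite -lee_fin -!hat_point -!integral_hat//.
apply: ge0_le_integral_unmeasured => eta _; rewrite lee_fin.
  by have /andP[] := hat_ge0_le1 eta (admissible_range ap).
apply: le_hat => y; rewrite pp andbT.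
by have /andP[] := admissible_range ap y.
Qed.

End nonlinear_flow.

(** * Short-time estimates from the mild equation *)

Section constant_in_time_bounds.
Context {R : realType}.

Lemma lebesgue_measure_itv0 (t : R) : 0 <= t ->
  lebesgue_measure (`[0, t]%classic : set (measurableTypeR R)) = t%:E.
Proof.
rewrite lebesgue_measure_itv/= lte_fin le_eqVlt.
by move=> /predU1P[<-|->]; rewrite ?ltxx// -EFinB subr0.
Qed.

Lemma Rintegral_itv_bounds (F : R -> R) (t a b : R) : 0 <= t ->
    (forall s, 0 <= s <= t -> a <= F s <= b) ->
  a * t <= \int[lebesgue_measure]_(s in `[0, t]) F s <= b * t.
Proof.
move=> t0 Fab; pose D : set (measurableTypeR R) := `[0, t]%classic.
have mD : measurable D by exact: measurable_itv.
have muD : lebesgue_measure D = t%:E by exact: lebesgue_measure_itv0.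
have Dy : (lebesgue_measure D < +oo)%E by rewrite muD ltry.
have cD (r : R) : \int[lebesgue_measure]_(s in D) r = r * t.
  have -> : r * t = r * fine (lebesgue_measure D) by rewrite muD.
  exact: Rintegral_cst.
rewrite -[a * t]cD -[b * t]cD.
have FD s : D s -> a <= F s <= b by rewrite /D /= in_itv /=; exact: Fab.
have aM : a <= Num.max `|a| `|b| by rewrite le_max ler_norm.
have bM : b <= Num.max `|a| `|b| by rewrite le_max ler_norm orbT.
have NaM : - a <= Num.max `|a| `|b|.
  by rewrite le_max -normrN ler_norm.
have FM s : D s -> `|F s| <= Num.max `|a| `|b|.
  move=> /FD /andP[aF Fb]; rewrite ler_norml (le_trans Fb bM) andbT.
  by rewrite lerNl; apply: le_trans NaM; rewrite lerN2.
by apply/andP; split;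
  apply: (le_Rintegral_bounded (M := Num.max `|a| `|b|) mD Dy) => s Ds;
  rewrite ?FM ?le_max ?lexx ?orbT//; have /andP[] := FD _ Ds.
Qed.

End constant_in_time_bounds.

Section flow_estimates.
Context {R : realType} {d : nat}.
Local Notation rV := 'rV[R]_d.
Local Notation configB := (borel (config R d)).
Variables (q : nat -> R) (H : R -> R.-pker configB ~> configB).
Hypothesis q_ge0 : forall k, (1 <= k)%N -> 0 <= q k.
Hypothesis q_sum : (\sum_(1 <= k <oo) (q k)%:E = 1)%E.
Hypothesis hT : transition_function H.
Hypothesis hB : branching_transition q H.
Implicit Types (psi h : rV -> R) (x : rV) (s t a b : R).
Local Notation flow := (flow H).

Lemma admissible_cst b : 0 <= b <= 1 -> admissible (fun=> b : R) (d := d).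
Proof. by move=> b01; apply: continuous_admissible => //; exact: cst_continuous. Qed.

Lemma reaction_le0 r : 0 <= r <= 1 -> reaction q r <= 0.
Proof.
move=> r01; apply: le_trans (reaction_le_logistic q_ge0 q_sum (leqnn 2) r01) _.
have /andP[r0 r1] := r01.
by rewrite oppr_le0 !mulr_ge0 ?q_ge0// subr_ge0.
Qed.

Lemma flow_reaction_norm psi t x : admissible psi -> 0 <= t ->
  `|reaction q (flow t psi x)| <= 1.
Proof.
move=> ap t0; have r01 := flow_range hB x ap t0; have /andP[r0 r1] := r01.
rewrite ler0_norm ?reaction_le0//; have := reaction_ge q_ge0 r01; lra.
Qed.

Lemma flow_le psi t x a : admissible psi -> 0 <= t ->
    (forall s, 0 <= s <= t ->
      heat (t - s) (fun y => reaction q (flow s psi y)) x <= - a) ->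
  flow t psi x <= heat t psi x - a * t.
Proof.
move=> ap t0 ha; rewrite (flow_mild hB)// lerD2l -mulNr.
apply: (andP (@Rintegral_itv_bounds _
  (fun s => heat (t - s) (fun y => reaction q (flow s psi y)) x) t (- 1) (- a) t0 _)).2.
move=> s st; rewrite ha// andbT; have /andP[s0 _] := st.
have := @heat_bounded _ _ (t - s) (fun y => reaction q (flow s psi y)) x 1
  (fun y => flow_reaction_norm y ap s0).
by rewrite ler_norml => /andP[].
Qed.

Lemma flow_ge psi t x a : admissible psi -> 0 <= t ->
    (forall s, 0 <= s <= t ->
      - a <= heat (t - s) (fun y => reaction q (flow s psi y)) x) ->
  heat t psi x - a * t <= flow t psi x.
Proof.
move=> ap t0 ha; rewrite (flow_mild hB)// lerD2l -mulNr.
apply: (andP (@Rintegral_itv_bounds _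
  (fun s => heat (t - s) (fun y => reaction q (flow s psi y)) x) t (- a) 1 t0 _)).1.
move=> s st; rewrite ha//=; have /andP[s0 _] := st.
have := @heat_bounded _ _ (t - s) (fun y => reaction q (flow s psi y)) x 1
  (fun y => flow_reaction_norm y ap s0).
by rewrite ler_norml => /andP[].
Qed.

Lemma flow_le_heat psi t x : admissible psi -> 0 <= t ->
  flow t psi x <= heat t psi x.
Proof.
move=> ap t0; rewrite -[leRHS]subr0 -[X in _ - X](mul0r t).
apply: flow_le => // s /andP[s0 _]; rewrite oppr0 -[leRHS](heat_cst (t - s) 0 x).
apply: (@le_heat _ _ _ _ _ _ 1) => y.
- exact: flow_reaction_norm.
- by rewrite normr0.
- by apply: reaction_le0; exact: (flow_range hB).
Qed.

Lemma flow_cst_le b t x : 0 <= b <= 1 -> 0 <= t -> flow t (fun=> b) x <= b.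
Proof.
move=> b01 t0; rewrite -[leRHS](heat_cst t b x); apply: flow_le_heat => //.
exact: admissible_cst.
Qed.

(** A particle has not yet branched at time [t] with probability at least
[1 - t]. *)
Lemma flow_cst_ge b t x : 0 <= b <= 1 -> 0 <= t -> b * (1 - t) <= flow t (fun=> b) x.
Proof.
move=> b01 t0; have ab := admissible_cst b01; have /andP[b0 b1] := b01.
have -> : b * (1 - t) = heat t (fun=> b) x - b * t by rewrite heat_cst; lra.
apply: flow_ge => // s /andP[s0 _]; rewrite -[leLHS](heat_cst (t - s) (- b) x).
apply: (@le_heat _ _ _ _ _ _ 1) => y.
- by rewrite normrN ger0_norm.
- exact: flow_reaction_norm.
- apply: le_trans (reaction_ge q_ge0 (flow_range hB y ab s0)).
  by rewrite lerN2; exact: flow_cst_le.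
Qed.

(** The profiles along which the population is compared with a growing one: the
constant [1] (with [lam = 0]) and the wide Gaussian bumps (with small [lam]). *)
Record slowly_decaying (lam : R) (h : rV -> R) : Prop := SlowlyDecaying {
  slow_continuous : continuous h;
  slow_range : forall x, 0 <= h x <= 1;
  slow_affine : forall a b t x,
    heat t (fun y => a + b * h y) x = a + b * heat t h x;
  slow_heat : forall t x, 0 <= t -> (1 - lam * t) * h x <= heat t h x }.

Lemma admissible_bump h a : continuous h -> (forall x, 0 <= h x <= 1) ->
  0 <= a <= 1 -> admissible (fun x => 1 - a * h x).
Proof.
move=> hc h01 a01; apply: continuous_admissible => [x|x].
  exact: (cvgB (cvg_cst (1 : R)) (cvgM (cvg_cst a) (hc x))).
have /andP[h0 h1] := h01 x; have /andP[a0 a1] := a01.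
have ? : 0 <= a * h x by rewrite mulr_ge0.
have ? : a * h x <= 1 by rewrite mulr_ile1.
by apply/andP; split; lra.
Qed.

Lemma slowly_decaying_cst : slowly_decaying 0 (fun=> 1).
Proof.
split=> [|x|a b t x|t x t0]; rewrite ?heat_cst ?ler01 ?lexx//.
  exact: cst_continuous.
by rewrite mul0r subr0 mul1r.
Qed.

Section logistic_growth.
Variable K : nat.
Hypothesis K2 : (2 <= K)%N.
Let c := q K.

Lemma branching_rate_ge0_le1 : 0 <= c <= 1.
Proof.
rewrite q_ge0 ?(ltnW K2)//=; apply: le_trans (partial_sum_le1 q_ge0 q_sum K.+1).
rewrite big_nat_recr ?(ltnW K2)//= lerDr big_nat sumr_ge0// => k /andP[k1 _].
exact: q_ge0.
Qed.

(** The heat flow costs the factor [1 - lam * t], while the logistic bound on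
the reaction gains: up to time [t] the value [v] of the flow satisfies
[(1 - a) / 2 <= v] because there may have been no branching, and
[(1 - lam * t) * (a * h) <= 1 - v] by comparison with the heat flow, so that
[v * (1 - v)] is bounded below by a multiple of [a * h]. *)
Lemma flow_bump_le lam h a t x : slowly_decaying lam h ->
    0 <= lam -> 0 <= a <= 1 -> 0 <= t <= 2^-1 -> lam * t <= 1 ->
  flow t (fun y => 1 - a * h y) x <=
  1 - (1 - lam * t) * (1 + c * ((1 - a) / 2) * t * (1 - lam * t)) * (a * h x).
Proof.
move=> sh lam0 a01 /andP[t0 t2] lt1.
have /andP[a0 a1] := a01; have /andP[c0 c1] := branching_rate_ge0_le1.
have ap := admissible_bump (slow_continuous sh) (slow_range sh) a01.
have hh y : 0 <= h y <= 1 := slow_range sh y.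
set psi := fun y => _.
pose m := 1 - lam * t; have m0 : 0 <= m by rewrite /m; lra.
have heat_psi s y : 0 <= s <= t -> heat s psi y <= 1 - m * (a * h y).
  move=> /andP[s0 st].
  have -> : psi = (fun y => 1 + (- a) * h y).
    by apply/funext => z; rewrite /psi mulNr.
  rewrite (slow_affine sh) mulNr lerD2l lerN2 mulrCA ler_wpM2l//.
  apply: le_trans (slow_heat sh y s0); have /andP[h0 _] := hh y.
  by rewrite ler_wpM2r// /m; have := ler_wpM2l lam0 st; lra.
pose C := c * ((1 - a) / 2) * m * a.
have C0 : 0 <= C by rewrite /C !mulr_ge0//; lra.
have ? : flow t psi x <= heat t psi x - (C * m * h x) * t.
  apply: flow_le => // s /andP[s0 st].
  apply: (@le_trans _ _ (heat (t - s) (fun y => 0 + (- C) * h y) x)).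
    apply: (@le_heat _ _ _ _ _ _ (1 + C)) => y.
    - by apply: le_trans (flow_reaction_norm y ap s0) _; rewrite lerDl.
    - have /andP[h0 h1] := hh y.
      rewrite add0r mulNr normrN ger0_norm; last exact: mulr_ge0.
      by have := ler_wpM2l C0 h1; lra.
    - have v01 := flow_range hB y ap s0; set v := flow s psi y in v01 *.
      have vu : v <= 1 - m * (a * h y).
        apply: le_trans (flow_le_heat y ap s0) _.
        by apply: heat_psi; rewrite s0.
      have vl : (1 - a) / 2 <= v.
        have c01 : 0 <= 1 - a <= 1 by lra.
        apply: (@le_trans _ _ (flow s (fun=> 1 - a) y)).
          apply: le_trans (flow_cst_ge y c01 s0).
          by rewrite ler_wpM2l; lra.
        apply: (le_flow hB) => // [|z]; first exact: admissible_cst.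
        have /andP[h0 h1] := hh z.
        by rewrite /psi lerD2l lerN2 ler_piMr.
      apply: le_trans (reaction_le_logistic q_ge0 q_sum K2 v01) _.
      rewrite add0r mulNr lerN2 -/c /C -!mulrA ler_wpM2l//.
      rewrite mulrA; apply: ler_pM => //; [lra| |lra].
      by have /andP[h0 _] := hh y; rewrite !mulr_ge0.
  rewrite (slow_affine sh) add0r mulNr lerN2 -mulrA ler_wpM2l//.
  have ts0 : 0 <= t - s by rewrite subr_ge0.
  apply: le_trans (slow_heat sh x ts0); have /andP[h0 _] := hh x.
  by rewrite ler_wpM2r// /m; have := mulr_ge0 lam0 s0; lra.
have := heat_psi t x; rewrite t0 lexx => /(_ isT) ?.
rewrite -/m; have -> : m * (1 + c * ((1 - a) / 2) * t * m) * (a * h x) =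
  m * (a * h x) + C * m * h x * t by rewrite /C; ring.
lra.
Qed.

Lemma flow_half_cst_le b x : 0 <= b <= 1 ->
  flow 2^-1 (fun=> b) x <= b * (1 - c * (1 - b) / 4).
Proof.
move=> b01; have := @flow_bump_le 0 (fun=> 1) (1 - b) 2^-1 x slowly_decaying_cst.
have -> : (fun _ : rV => 1 - (1 - b) * 1) = fun=> b.
  by apply/funext => y; lra.
rewrite mul0r lexx => /(_ isT) h.
apply: le_trans (h _ _ _) _; [lra|lra|lra|].
lra.
Qed.

Lemma flow_half_iter_cst_le n b x : 0 <= b <= 1 ->
  flow (n%:R / 2) (fun=> b) x <= b * (1 - c * (1 - b) / 4) ^+ n.
Proof.
move=> b01; have /andP[b0 b1] := b01; set rho := 1 - _.
have /andP[c0 c1] := branching_rate_ge0_le1.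
have cb : 0 <= c * (1 - b) <= 1.
  by rewrite mulr_ge0 ?mulr_ile1// ?subr_ge0 //; lra.
have rho01 : 0 <= rho <= 1 by rewrite /rho; lra.
have /andP[rho0 rho1] := rho01.
elim: n x => [|n IH] x.
  by rewrite mul0r expr0 mulr1; apply: flow_cst_le.
have n20 : 0 <= n%:R / 2 :> R by rewrite divr_ge0.
have ab := admissible_cst b01.
have -> : n.+1%:R / 2 = 2^-1 + n%:R / 2 :> R by rewrite -natr1; lra.
rewrite (flowD hT hB)//; set b' := b * rho ^+ n in IH *.
have rn1 : rho ^+ n <= 1 by rewrite exprn_ile1.
have b'b : b' <= b by rewrite /b' ler_piMr.
have b'0 : 0 <= b' by rewrite /b' mulr_ge0 ?exprn_ge0.
have b'01 : 0 <= b' <= 1 by rewrite b'0 (le_trans b'b).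
apply: (@le_trans _ _ (flow 2^-1 (fun=> b') x)).
  by apply: (le_flow hB) => //; [exact: (flow_admissible hB)|exact: admissible_cst].
apply: le_trans (flow_half_cst_le x b'01) _.
rewrite exprSr mulrA -/b' ler_wpM2l// /rho.
by have := ler_wpM2l c0 b'b; lra.
Qed.

(** For [a <= 2^-1] the gain is at least the fraction [c * t / 4 * (1 - lam * t)]
of the profile, which exceeds the cost [lam * t] of the heat flow when
[lam <= c / 16]. *)
Lemma flow_bump_growth lam h a t x : slowly_decaying lam h ->
    0 <= lam <= c / 16 -> 0 <= a <= 2^-1 -> 0 <= t <= 2^-1 ->
  flow t (fun y => 1 - a * h y) x <= 1 - (1 + c * t / 8) * (a * h x).
Proof.
move=> sh /andP[lam0 lamc] /andP[a0 a2] t02; have /andP[t0 t2] := t02.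
have /andP[c0 c1] := branching_rate_ge0_le1.
have lt : 0 <= lam * t by rewrite mulr_ge0.
have ltc : lam * t <= c * t / 16 by have := ler_wpM2r t0 lamc; lra.
have ct : c * t <= 2^-1 by have := ler_wpM2r t0 c1; lra.
apply: (le_trans (@flow_bump_le lam h a t x sh lam0 _ t02 _)); [lra|lra|].
rewrite lerD2l lerN2 ler_wpM2r//.
  by rewrite mulr_ge0//; have /andP[] := slow_range sh x.
set p := lam * t in lt ltc *; set z := c * t in ltc ct *.
have z0 : 0 <= z by rewrite mulr_ge0.
have -> : c * ((1 - a) / 2) * t = z * ((1 - a) / 2) by rewrite /z; ring.
have : 0 <= z * (2^-1 - a) by rewrite mulr_ge0//; lra.
have : 0 <= z * p by rewrite mulr_ge0.
have : 0 <= z * (1 - a) * (p * p) by rewrite !mulr_ge0//; lra.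
have : z * p * (1 - a) <= z / 32.
  have := ler_wpM2l z0 (_ : p * (1 - a) <= 32^-1); rewrite mulrA; apply.
  have : p * (1 - a) <= p by rewrite ler_piMr; lra.
  lra.
move=> ? ? ? ?; nra.
Qed.

(** The short steps of [flow_bump_growth] do not decrease the level [2^-1], and
every time is a sum of equal short steps. *)
Lemma flow_bump_keep lam h t x : slowly_decaying lam h ->
    0 <= lam <= c / 16 -> 0 <= t ->
  flow t (fun y => 1 - 2^-1 * h y) x <= 1 - 2^-1 * h x.
Proof.
move=> sh lamc t0; have /andP[c0 _] := branching_rate_ge0_le1.
have h201 : 0 <= (2^-1 : R) <= 1 by lra.
have ap := admissible_bump (slow_continuous sh) (slow_range sh) h201.
have step r y : 0 <= r <= 2^-1 ->
    flow r (fun y => 1 - 2^-1 * h y) y <= 1 - 2^-1 * h y.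
  move=> r02; have /andP[r0 _] := r02; have h20 : 0 <= (2^-1 : R) <= 2^-1 by lra.
  apply: le_trans (flow_bump_growth y sh lamc h20 r02) _.
  rewrite lerD2l lerN2 mulrDl mul1r lerDl.
  have /andP[h0 _] := slow_range sh y.
  by have := mulr_ge0 (mulr_ge0 c0 r0) h0; lra.
pose n := (Num.truncn (2 * t)).+1.
have n0 : 0 < n%:R :> R by rewrite ltr0n.
have tn : 2 * t < n%:R by apply: truncnS_gt.
pose r := t / n%:R.
have r02 : 0 <= r <= 2^-1.
  by rewrite /r divr_ge0 ?(ltW n0)//= ler_pdivrMr//; lra.
have /andP[r0 _] := r02.
suff iter k y : flow (k.+1%:R * r) (fun y => 1 - 2^-1 * h y) y <= 1 - 2^-1 * h y.
  have := iter n.-1 x; rewrite prednK// /r [n%:R * _]mulrC divfK//.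
  by rewrite gt_eqF.
elim: k y => [|k IH] y; first by rewrite mul1r; exact: step.
have -> : k.+2%:R * r = r + k.+1%:R * r by rewrite -[k.+2%:R]natr1; lra.
have kr : 0 <= k.+1%:R * r by rewrite mulr_ge0.
rewrite (flowD hT hB)//; apply: le_trans (step r y r02).
by apply: (le_flow hB) => //; exact: (flow_admissible hB).
Qed.

(** Each step of length [2^-1] multiplies the level by [rho > 1] until the level
[2^-1], up to which growth is guaranteed, is reached. *)
Lemma flow_bump_saturates lam h e : slowly_decaying lam h -> 0 < c ->
    0 <= lam <= c / 16 -> 0 < e <= 2^-1 ->
  exists n, forall x, flow (n%:R / 2) (fun y => 1 - e * h y) x <= 1 - 2^-1 * h x.
Proof.
move=> sh c0 lamc /andP[e0 e2].
pose rho := 1 + c / 16; have rho1 : 1 < rho by rewrite /rho; lra.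
pose a n := Num.min (rho ^+ n * e) 2^-1.
have rn n : 0 < rho ^+ n by rewrite exprn_gt0//; lra.
have a02 n : 0 <= a n <= 2^-1.
  have re0 : 0 <= rho ^+ n * e by rewrite mulr_ge0// ltW.
  by rewrite /a ge_min lexx orbT andbT le_min re0 invr_ge0 ler0n.
have aS n : a n.+1 <= rho * a n.
  rewrite /a exprS -mulrA ge_min; have [ale|agt] := leP (rho ^+ n * e) 2^-1.
    by rewrite lexx.
  by apply/orP; right; rewrite -[leLHS]mul1r ler_wpM2r// ltW.
have a01 n : 0 <= a n <= 1 by have := a02 n; lra.
have adm n := admissible_bump (slow_continuous sh) (slow_range sh) (a01 n).
have step n x : flow (n.+1%:R / 2) (fun y => 1 - e * h y) x <= 1 - a n.+1 * h x.
  have half : 0 <= (2^-1 : R) <= 2^-1 by lra.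
  have ha m y : flow 2^-1 (fun y => 1 - a m * h y) y <= 1 - a m.+1 * h y.
    apply: le_trans (flow_bump_growth y sh lamc (a02 m) half) _.
    rewrite lerD2l lerN2 mulrA ler_wpM2r//; first by have /andP[] := slow_range sh y.
    by apply: le_trans (aS m) _; rewrite ler_wpM2r ?/rho; have := a02 m; lra.
  have e01 : 0 <= e <= 1 by lra.
  have ae := admissible_bump (slow_continuous sh) (slow_range sh) e01.
  elim: n x => [|n IH] x.
    rewrite mul1r; have <- : a 0%N = e by rewrite /a expr0 mul1r; exact/min_idPl.
    exact: ha.
  have n20 : 0 <= n.+1%:R / 2 :> R by rewrite divr_ge0.
  have -> : n.+2%:R / 2 = 2^-1 + n.+1%:R / 2 :> R by rewrite -[n.+2%:R]natr1; lra.
  rewrite (flowD hT hB)//; apply: le_trans (ha n.+1 x).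
  by apply: (le_flow hB) => //; exact: (flow_admissible hB).
have [n rne] : exists n, 2^-1 <= rho ^+ n * e.
  pose m := (Num.truncn (2^-1 / e / (rho - 1))).+1.
  have hm : 2^-1 / e / (rho - 1) < m%:R by apply: truncnS_gt.
  exists m; rewrite -ler_pdivrMr//.
  have rho10 : 0 < rho - 1 by rewrite subr_gt0.
  move: hm; rewrite ltr_pdivrMr// => /ltW /le_trans; apply.
  have := @bernoulli_ineq R (rho - 1) m; rewrite addrC subrK => bern.
  by have := bern (ltW (lt_trans ltr01 rho1)); lra.
exists n.+1 => x; apply: le_trans (step n x) _.
suff -> : a n.+1 = 2^-1 by [].
apply/min_idPr; apply: le_trans rne _.
by rewrite ler_wpM2r ?(ltW e0)// exprS ler_peMl// ltW.
Qed.

End logistic_growth.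
End flow_estimates.

(** * The hair trigger effect *)

Section gaussian_bumps.
Context {R : realType} {d : nat}.
Local Notation rV := 'rV[R]_d.
Implicit Types (x y : rV) (L t : R).

Definition bump (L : R) (x : rV) (y : rV) : R := \prod_i bump1 L (x 0 i) (y 0 i).

Lemma bump_range L x y : 0 < L -> 0 <= bump L x y <= 1.
Proof.
move=> L0; apply/andP; split.
  by apply: prodr_ge0 => i _; have /andP[] := bump1_ge0_le1 (x 0 i) (y 0 i) L0.
by apply: prodr_ile1 => i _; exact: bump1_ge0_le1.
Qed.

Lemma continuous_bump L x : continuous (bump L x).
Proof.
apply: continuous_prod_seq => i y.
apply: (@continuous_comp _ _ _ (fun z : rV => z 0 i) (bump1 L (x 0 i))).
  exact: coord_continuous.
exact: continuous_bump1.
Qed.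

Lemma slowly_decaying_bump L x : (0 < d)%N -> 0 < L ->
  slowly_decaying (2 * d%:R / L) (bump L x).
Proof.
move=> d0 L0; pose k i z := bump1 L (x 0 i) z.
have mk i : measurable_fun [set: R] (k i) by exact: measurable_bump1.
have k01 i z : 0 <= k i z <= 1 by exact: bump1_ge0_le1.
have heatE t y : heat t (bump L x) y =
    \prod_i \int[normal_prob 0 1]_z k i (y 0 i + Num.sqrt (2 * t) * z).
  have := @heat_affine_prod _ _ t k 0 1 y mk k01; rewrite add0r mul1r => <-.
  by congr heat; apply/funext => z; rewrite add0r mul1r.
split.
- exact: continuous_bump.
- by move=> y; exact: bump_range.
- by move=> a b t y; rewrite heatE (heat_affine_prod _ _ _ _ mk k01).
- move=> t y t0; rewrite heatE.
  have s2 : Num.sqrt (2 * t) ^+ 2 = 2 * t by rewrite sqr_sqrtr// mulr_ge0.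
  have [tL|Lt] := leP (2 * t / L) 1; last first.
    apply: (@le_trans _ _ 0); last first.
      apply: prodr_ge0 => i _; apply: Rintegral_ge0 => z _.
      by have /andP[] := k01 i (y 0 i + Num.sqrt (2 * t) * z).
    apply: mulr_le0_ge0; last by have /andP[] := bump_range x y L0.
    have d1 : 1 <= d%:R :> R by rewrite ler1n.
    have : 0 <= (d%:R - 1) * (2 * t / L).
      by rewrite mulr_ge0 ?subr_ge0// ltW// (lt_trans _ Lt).
    have -> : 2 * d%:R / L * t = d%:R * (2 * t / L) by ring.
    lra.
  apply: (@le_trans _ _ (\prod_(i < d) ((1 - 2 * t / L) * k i (y 0 i)))).
    rewrite big_split /= prodr_const card_ord ler_wpM2r//.
      by have /andP[] := bump_range x y L0.
    have -> : 1 - 2 * d%:R / L * t = 1 + d%:R * - (2 * t / L) by ring.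
    by apply: bernoulli_ineq; rewrite subr_ge0.
  apply: ler_prod => i _; have /andP[k0 _] := k01 i (y 0 i).
  have := normal_mean_bump1 (x 0 i) (y 0 i) (Num.sqrt (2 * t)) L0.
  by rewrite s2 => ->; rewrite mulr_ge0 ?subr_ge0.
Qed.

(** Near [x0] the function stays below [1 - eta], and the heat flow at time [L]
spreads the indicator of a cube into a multiple of the bump of width [L]. *)
Lemma heat_le_bump (psi : rV -> R) (x0 x : rV) L : (forall y, 0 <= psi y <= 1) ->
    continuous psi -> psi x0 < 1 -> 0 < L ->
  exists2 e, 0 < e <= 2^-1 & forall y, heat L psi y <= 1 - e * bump L x y.
Proof.
move=> p01 pc px0 L0.
pose eta := (1 - psi x0) / 2.
have eta0 : 0 < eta by rewrite divr_gt0// subr_gt0.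
have : nbhs x0 [set y | psi y <= 1 - eta].
  have /cvgr_le := pc x0; apply; rewrite /eta; lra.
move=> /nbhs_ballP[rho /= rho0 Hrho].
pose s := Num.sqrt (2 * L).
have s0 : 0 < s by rewrite sqrtr_gt0 mulr_gt0.
have s2 : s ^+ 2 / 2 = L by rewrite sqr_sqrtr ?mulr_ge0 ?(ltW L0)// mulrC mulKf.
pose k i : R -> R := \1_(`]x0 0 i - rho, x0 0 i + rho[ : set R).
have mk i : measurable_fun [set: R] (k i).
  by apply: measurable_indic; exact: measurable_itv.
have k01 i z : 0 <= k i z <= 1.
  by rewrite /k indicE; case: (_ \in _); rewrite ?ler01 ?lexx.
have /choice[e He] : forall i : 'I_d, exists e : R, 0 < e /\ forall y : R,
    e * bump1 L (x 0 i) y <= \int[normal_prob 0 1]_z k i (y + s * z).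
  move=> i; have [e e0 h] := normal_mean_interval (x 0 i) (x0 0 i) s0 rho0.
  by exists e; split => // y; rewrite -s2; exact: h.
pose e' := eta * \prod_i e i.
have e'0 : 0 < e' by rewrite mulr_gt0//; apply: prodr_gt0 => i _; have [] := He i.
exists (Num.min e' 2^-1); first by rewrite ge_min lexx orbT andbT lt_min e'0/=; lra.
move=> y; have /andP[b0 _] := bump_range x y L0.
apply: (@le_trans _ _ (1 - e' * bump L x y)); last first.
  by rewrite lerD2l lerN2 ler_wpM2r// ge_min lexx.
apply: (@le_trans _ _ (heat L (fun z => 1 + (- eta) * \prod_i k i (z 0 i)) y)).
  apply: (@le_heat _ _ _ _ _ _ (1 + eta)) => z.
  - have /andP[p0 p1] := p01 z; rewrite ger0_norm//; lra.
  - have : 0 <= \prod_i k i (z 0 i) <= 1.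
      apply/andP; split; first by apply: prodr_ge0 => i _; have /andP[] := k01 i (z 0 i).
      by apply: prodr_ile1 => i _; exact: k01.
    move=> /andP[P0 P1].
    apply: (le_trans (ler_normD _ _)); rewrite normr1 lerD2l normrM normrN.
    by rewrite !ger0_norm ?(ltW eta0)// ler_piMr// ltW.
  - have [zin|/existsNP[i zout]] := pselect (forall i, `|x0 0 i - z 0 i| < rho).
      have -> : \prod_i k i (z 0 i) = 1.
        apply: big1 => i _; rewrite /k indicE mem_set//= in_itv /=.
        by have := zin i; rewrite ltr_norml => /andP[? ?]; apply/andP; split; lra.
      rewrite mulr1; apply: Hrho; split => // i j.
      by rewrite ord1; exact: zin.
    have -> : \prod_i k i (z 0 i) = 0.
      rewrite (bigD1 i)//= /k indicE memNset ?mul0r//= in_itv /=.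
      move=> /andP[? ?]; apply: zout; rewrite ltr_norml; apply/andP; split; lra.
    by rewrite mulr0 addr0; have /andP[] := p01 z.
rewrite (heat_affine_prod _ _ _ _ mk k01) mulNr lerD2l lerN2 /e' -mulrA.
rewrite ler_wpM2l ?(ltW eta0)// /bump -big_split /=.
apply: ler_prod => i _; have [e0 he] := He i.
rewrite he andbT mulr_ge0 ?(ltW e0)//.
by have /andP[] := bump1_ge0_le1 (x 0 i) (y 0 i) L0.
Qed.

Lemma cvg_bump x y : bump n.+1%:R x y @[n --> \oo] --> (1 : R).
Proof.
suff : bump n.+1%:R x y @[n --> \oo] --> \prod_(i < d) (1 : R) by rewrite big1.
apply: cvg_prod_seq => i; rewrite /bump1.
have -> : (fun n : nat => expR (- ((y 0 i - x 0 i) ^+ 2 / (2 * n.+1%:R)))) =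
    expR \o (fun n => (- ((y 0 i - x 0 i) ^+ 2 / 2)) * harmonic n).
  by apply/funext => n /=; congr expR; rewrite invfM; ring.
rewrite -[X in _ --> X](@expR0 R).
apply: continuous_cvg; first exact: continuous_expR.
rewrite -[X in _ --> X](mulr0 (- ((y 0 i - x 0 i) ^+ 2 / 2))).
exact: (cvgM (cvg_cst _) (@cvg_harmonic R)).
Qed.

End gaussian_bumps.

Section hair_trigger.
Context {R : realType} {d : nat}.
Local Notation rV := 'rV[R]_d.
Local Notation configB := (borel (config R d)).
Variables (q : nat -> R) (H : R -> R.-pker configB ~> configB).
Hypothesis q_ge0 : forall k, (1 <= k)%N -> 0 <= q k.
Hypothesis q_sum : (\sum_(1 <= k <oo) (q k)%:E = 1)%E.
Hypothesis hT : transition_function H.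
Hypothesis hB : branching_transition q H.
Implicit Types (psi : rV -> R) (x : rV) (t : R).

(** Continuity of the flow in the initial value is dominated convergence under
the transition kernel, as [hat] is a finite product at each configuration. *)
Lemma flow_cvg (psi_ : nat -> rV -> R) psi t x : (forall n, admissible (psi_ n)) ->
    admissible psi -> 0 <= t -> (forall y, psi_ n y @[n --> \oo] --> psi y) ->
  flow H t (psi_ n) x @[n --> \oo] --> flow H t psi x.
Proof.
move=> ap_ ap t0 pp.
suff : (flow H t (psi_ n) x)%:E @[n --> \oo] --> (flow H t psi x)%:E.
  by move=> /fine_cvg.
rewrite (_ : (fun n => _) =
    (fun n => \int[H t (point_config x)]_eta (hat (psi_ n) eta)%:E)%E); last first.
  by apply/funext => n; rewrite (integral_hat hB)// hat_point.
rewrite -[X in X%:E]hat_point -(integral_hat hB)//.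
apply: (@dominated_cvg _ _ _ (H t (point_config x)) setT measurableT
  (fun n eta => (hat (psi_ n) eta)%:E) _ (fun=> 1%E)) => //.
- by move=> n; apply/measurable_EFinP; exact: admissible_hat.
- move=> eta _; apply: cvg_EFin; first exact: nearW.
  by apply: cvg_prod_seq => y; exact: pp.
- apply/integrableP; split; first exact: measurable_cst.
  rewrite integral_cst//= normr1 mul1e prob_kernel.
  exact: ltry.
- move=> n eta _; have /andP[h0 h1] := hat_ge0_le1 eta (admissible_range (ap_ n)).
  by rewrite /= lee_fin ger0_norm.
Qed.

(** The level [2^-1] of the bump is kept forever once it is reached, whatever the
width; the flow of the constant [2^-1] decays geometrically; and a bump wide
enough is indistinguishable at [x] from the constant [1] for the fixed time
[n1 / 2] that this decay needs. *)
Lemma hair_trigger_effect psi x0 x (K : nat) (eps : R) :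
    (2 <= K)%N -> 0 < q K -> (0 < d)%N ->
    continuous psi -> (forall y, 0 <= psi y <= 1) -> psi x0 < 1 -> 0 < eps ->
  exists2 T, 0 <= T & forall t, T <= t -> flow H t psi x <= eps.
Proof.
move=> K2 c0 d0 pc p01 px0 eps0; set c := q K in c0.
have ap := continuous_admissible pc p01.
have h01 : 0 <= (2^-1 : R) <= 1 by lra.
have /andP[_ c1] := branching_rate_ge0_le1 q_ge0 q_sum K2; rewrite -/c in c1.
(* [n1] must be chosen before the width [n.+1] of the bump. *)
have [n1 Hn1] : exists n1, flow H (n1%:R / 2) (fun=> 2^-1) x < eps.
  pose rho := 1 - c * (1 - 2^-1) / 4.
  have rho1 : `|rho| < 1 by rewrite ger0_norm /rho; lra.
  have := @cvg_geometric R 2^-1 rho rho1.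
  move=> /cvgr_lt /(_ eps eps0)[N _ /(_ N (leqnn N))] /= hN.
  by exists N; apply: le_lt_trans hN; exact: (flow_half_iter_cst_le q_ge0 q_sum hT hB).
have n10 : 0 <= n1%:R / 2 :> R by rewrite divr_ge0.
have sl L := @slowly_decaying_bump R d L x d0.
have aL n : admissible (fun y => 1 - 2^-1 * bump n.+1%:R x y).
  by apply: admissible_bump => //; [exact: continuous_bump|move=> y; exact: bump_range].
have [n [nc Hn]] : exists n : nat, 2 * d%:R / n.+1%:R <= c / 16 /\
    flow H (n1%:R / 2) (fun y => 1 - 2^-1 * bump n.+1%:R x y) x <= eps.
  have C1 : 2 * d%:R / n.+1%:R @[n --> \oo] --> (0 : R).
    rewrite -[X in _ --> X](mulr0 (2 * d%:R)).
    exact: (cvgM (cvg_cst _) (@cvg_harmonic R)).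
  have C2 : flow H (n1%:R / 2) (fun y => 1 - 2^-1 * bump n.+1%:R x y) x @[n --> \oo]
      --> flow H (n1%:R / 2) (fun=> 2^-1) x.
    apply: flow_cvg => // [|y]; first exact: admissible_cst.
    rewrite [X in _ --> X](_ : _ = 1 - 2^-1 * 1); last by lra.
    exact: (cvgB (cvg_cst (1 : R)) (cvgM (cvg_cst (2^-1 : R)) (cvg_bump x y))).
  have c160 : 0 < c / 16 by lra.
  have /cvgr_le/(_ _ c160)[N1 _ h1] := C1.
  have /cvgr_le/(_ _ Hn1)[N2 _ h2] := C2.
  exists (maxn N1 N2); split; first by apply: h1; exact: leq_maxl.
  by apply: h2; exact: leq_maxr.
pose L : R := n.+1%:R; have L0 : 0 < L by rewrite ltr0n.
pose h := bump L x.
have sh : slowly_decaying (2 * d%:R / L) h by exact: sl.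
have lamc : 0 <= 2 * d%:R / L <= c / 16.
  by rewrite nc andbT divr_ge0 ?mulr_ge0// ltW.
have [e /andP[e0 e2] He] := heat_le_bump x p01 pc px0 L0.
have e02 : 0 < e <= 2^-1 by rewrite e0.
have e01 : 0 <= e <= 1 by lra.
have [n2 Hn2] := flow_bump_saturates q_ge0 q_sum hT hB K2 sh c0 lamc e02.
have n20 : 0 <= n2%:R / 2 :> R by rewrite divr_ge0.
have ae : admissible (fun y => 1 - e * h y).
  by apply: admissible_bump => //; [exact: (slow_continuous sh)|exact: (slow_range sh)].
have ah : admissible (fun y => 1 - 2^-1 * h y) by exact: aL.
exists (n1%:R / 2 + (n2%:R / 2 + L)); first by rewrite !addr_ge0// ltW.
move=> t Tt; pose r := t - (n1%:R / 2 + (n2%:R / 2 + L)).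
have r0 : 0 <= r by rewrite subr_ge0.
have -> : t = n1%:R / 2 + (r + (n2%:R / 2 + L)) by rewrite /r; lra.
have a1 := flow_admissible hB ap (ltW L0).
have a2 := flow_admissible hB a1 n20.
have a3 := flow_admissible hB a2 r0.
have n2L : 0 <= n2%:R / 2 + L by rewrite addr_ge0// ltW.
have E y : flow H (r + (n2%:R / 2 + L)) psi y =
    flow H r (flow H (n2%:R / 2) (flow H L psi)) y.
  rewrite (flowD hT hB)//; congr flow; apply/funext => z.
  by rewrite (flowD hT hB)// ltW.
have rn : 0 <= r + (n2%:R / 2 + L) by apply: addr_ge0.
rewrite (flowD hT hB)//.
have -> : flow H (r + (n2%:R / 2 + L)) psi =
  flow H r (flow H (n2%:R / 2) (flow H L psi)) by apply/funext.
apply: le_trans Hn; apply: (le_flow hB) => // y.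
apply: le_trans (flow_bump_keep q_ge0 q_sum hT hB K2 y sh lamc r0).
apply: (le_flow hB) => // z.
apply: le_trans (Hn2 z); apply: (le_flow hB) => // w.
by apply: le_trans (He w); apply: (flow_le_heat q_ge0 q_sum hB) => //; exact: ltW.
Qed.

End hair_trigger.

(** * Growth of the mean *)

Section mean_growth.
Context {R : realType} {d : nat}.
Local Notation rV := 'rV[R]_d.
Local Notation configB := (borel (config R d)).
Variables (q : nat -> R) (H : R -> R.-pker configB ~> configB).
Hypothesis q_ge0 : forall k, (1 <= k)%N -> 0 <= q k.
Hypothesis q_sum : (\sum_(1 <= k <oo) (q k)%:E = 1)%E.
Hypothesis q_mean_fin : (\sum_(1 <= k <oo) (k%:R * q k)%:E < +oo)%E.
Hypothesis hT : transition_function H.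
Hypothesis hB : branching_transition q H.
Implicit Types (psi phi : rV -> R) (x : rV) (t : R) (nu : configB).
Local Notation flow := (flow H).

(* The Malthusian parameter. *)
Let b := fine (\sum_(1 <= k <oo) ((k%:R - 1) * q k)%:E)%E.

Let b0 : 0 <= b.
Proof. by apply: series_fine_ge0 => k; exact: excess_term_ge0. Qed.

(** Gronwall's argument with the supremum [S] of [1 - flow s (1 - th)] over
[s <= r] and all points: the linear lower bound on the reaction gives
[S <= th + b * S * r]. *)
Lemma flow_cst_growth_sup r th x : 0 <= r -> b * r < 1 -> 0 <= th <= 1 ->
  1 - th / (1 - b * r) <= flow r (fun=> 1 - th) x.
Proof.
move=> r0 br th01; have c01 : 0 <= 1 - th <= 1 by lra.
have ac := @admissible_cst R d _ c01.
pose A := [set w | exists s y, 0 <= s <= r /\ w = 1 - flow s (fun=> 1 - th) y].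
have A01 w : A w -> 0 <= w <= 1.
  move=> [s [y [/andP[s0 _] ->]]]; have := flow_range hB y ac s0; lra.
have Ax : A (1 - flow r (fun=> 1 - th) x) by exists r, x; rewrite r0 lexx.
have ubA : has_ubound A by exists 1 => w /A01/andP[].
pose S := sup A.
have leS w : A w -> w <= S by move=> Aw; exact: ub_le_sup.
have S0 : 0 <= S by apply: le_trans (leS _ Ax); have /andP[] := A01 _ Ax.
have bS0 : 0 <= b * S by rewrite mulr_ge0.
have step s y : 0 <= s <= r -> 1 - flow s (fun=> 1 - th) y <= th + b * S * s.
  move=> /andP[s0 sr].
  suff : heat s (fun=> 1 - th) y - (b * S) * s <= flow s (fun=> 1 - th) y.
    by rewrite heat_cst; lra.
  apply: (flow_ge q_ge0 q_sum hB) => // s' /andP[s'0 s's].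
  rewrite -[leLHS](heat_cst (s - s') (- (b * S)) y).
  apply: (@le_heat _ _ _ _ _ _ (1 + b * S)) => z.
  - by rewrite normrN ger0_norm// lerDr.
  - by apply: le_trans (flow_reaction_norm q_ge0 q_sum hB z ac s'0) _; rewrite lerDl.
  - apply: le_trans (reaction_ge_linear q_ge0 q_sum q_mean_fin (flow_range hB z ac s'0)).
    rewrite lerN2 ler_wpM2l//; apply: leS; exists s', z.
    by rewrite s'0 (le_trans s's sr).
have SE : S <= th + b * S * r.
  apply: ge_sup; first by eexists; exact: Ax.
  move=> _ [s [y [sr ->]]]; apply: le_trans (step s y sr) _.
  by rewrite lerD2l ler_wpM2l//; have /andP[] := sr.
have br0 : 0 < 1 - b * r by rewrite subr_gt0.
have : S <= th / (1 - b * r) by rewrite ler_pdivlMr//; lra.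
have := leS _ Ax; lra.
Qed.

(** For short times [1 / (1 - b * r) <= expR (b' * r)], and the semigroup property
extends the bound to all times. *)
Lemma flow_cst_growth b' t th x : b < b' -> 0 <= t -> 0 <= th <= 1 ->
  1 - th * expR (b' * t) <= flow t (fun=> 1 - th) x.
Proof.
move=> bb' t0 th01; have b'0 : 0 < b' by exact: le_lt_trans bb'.
have short r c y : 0 <= r -> b * b' * r <= b' - b -> 0 <= c <= 1 ->
    1 - c * expR (b' * r) <= flow r (fun=> 1 - c) y.
  move=> r0 rb c01; have /andP[c0 c1] := c01.
  have br1 : b * r < 1.
    have [->|bn0] := eqVneq b 0; first by rewrite mul0r ltr01.
    have bgt0 : 0 < b by rewrite lt_neqAle eq_sym bn0.
    rewrite -(ltr_pM2l b'0) mulr1 mulrA (mulrC b').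
    by apply: le_lt_trans rb _; lra.
  apply: le_trans (flow_cst_growth_sup y r0 br1 c01).
  rewrite lerD2l lerN2 ler_wpM2l//.
  apply: (@le_trans _ _ (1 + b' * r)); last exact: expR_ge1Dx.
  rewrite -[leLHS]mul1r ler_pdivrMr ?subr_gt0//.
  have : 0 <= r * (b' - b - b * b' * r) by rewrite mulr_ge0// subr_ge0.
  lra.
pose n := (Num.truncn (b * b' * t / (b' - b))).+1.
have n0 : 0 < n%:R :> R by rewrite ltr0n.
have nb : b * b' * t / (b' - b) < n%:R by apply: truncnS_gt.
pose r := t / n%:R; have r0 : 0 <= r by rewrite divr_ge0// ltW.
have rb : b * b' * r <= b' - b.
  move: nb; rewrite ltr_pdivrMr ?subr_gt0// => /ltW.
  by rewrite /r mulrA ler_pdivrMr// [leRHS]mulrC.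
have tE : t = n%:R * r by rewrite /r mulrC divfK// gt_eqF.
suff iter k y : 1 - th * expR (b' * (k%:R * r)) <= flow (k%:R * r) (fun=> 1 - th) y.
  by rewrite tE; exact: iter.
elim: k y => [|k IH] y.
  rewrite mul0r mulr0 expR0 mulr1 -[leLHS]mulr1 -[X in _ * X]subr0.
  by apply: (flow_cst_ge q_ge0 q_sum hB) => //; lra.
pose c := Num.min (th * expR (b' * (k%:R * r))) 1.
have c01 : 0 <= c <= 1.
  by rewrite /c ge_min lexx orbT andbT le_min ler01 mulr_ge0 ?expR_ge0//; lra.
have kr0 : 0 <= k%:R * r by rewrite mulr_ge0.
have a1 : admissible (fun=> 1 - th : R) (d := d) by apply: admissible_cst; lra.
have a2 : admissible (fun=> 1 - c : R) (d := d) by apply: admissible_cst; lra.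
have -> : k.+1%:R * r = r + k%:R * r by rewrite -natr1; lra.
rewrite (flowD hT hB)//.
apply: (@le_trans _ _ (flow r (fun=> 1 - c) y)); last first.
  apply: (le_flow hB) => //; first exact: (flow_admissible hB).
  move=> z; rewrite /c; have [_|_] := leP (th * expR (b' * (k%:R * r))) 1.
    exact: IH.
  by rewrite subrr; have /andP[] := flow_range hB z a1 kr0.
apply: le_trans (short r c y r0 rb c01).
have -> : th * expR (b' * (r + k%:R * r)) =
    th * expR (b' * (k%:R * r)) * expR (b' * r) by rewrite mulrDr expRD; ring.
rewrite lerD2l lerN2.
by rewrite ler_wpM2r ?expR_ge0// /c ge_min lexx.
Qed.

Lemma one_minus_hat_le psi nu (B : R) : (forall x, 0 <= psi x <= 1) ->
    (forall x, 1 - psi x <= B) ->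
  1 - hat psi nu <= (size (enum_mset nu))%:R * B.
Proof.
move=> p01 pB; rewrite /hat; elim: (enum_mset nu) => [|x s IH].
  by rewrite big_nil subrr mul0r.
rewrite big_cons -natr1; have /andP[p0 p1] := p01 x.
have P01 : 0 <= \prod_(y <- s) psi y <= 1.
  apply/andP; split; first by apply: prodr_ge0 => y _; have /andP[] := p01 y.
  by apply: prodr_ile1 => y _; exact: p01.
have := pB x; have : 0 <= (1 - psi x) * (1 - \prod_(y <- s) psi y).
  by rewrite mulr_ge0//; lra.
lra.
Qed.

Lemma le_one_minus_expRN (z : R) : 0 <= z -> z / (1 + z) <= 1 - expR (- z).
Proof.
move=> z0; have z1 : 0 < 1 + z by lra.
have -> : z / (1 + z) = 1 - (1 + z)^-1 by field; rewrite gt_eqF.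
rewrite lerD2l lerN2 expRN lef_pV2 ?posrE ?expR_gt0//.
exact: expR_ge1Dx.
Qed.

(** Differentiation of the Laplace transform at [0]: with [e n] the inverse of
[n + 1] and [y] the pairing, [y / (1 + e n * y)] increases to [y] and is at most
[(1 - expR (- (e n * y))) / e n], whose mean the flow controls. *)
Lemma mean_pairing_le phi M b' t nu : b < b' -> 0 <= t -> continuous phi ->
    (forall x, 0 <= phi x <= M) ->
  (\int[H t nu]_eta (pairing phi eta)%:E <=
   ((size (enum_mset nu))%:R * (M * expR (b' * t)))%:E)%E.
Proof.
move=> bb' t0 pc pM; set B := _ * (M * _).
have p0 x : 0 <= phi x by have /andP[] := pM x.
have M0 : 0 <= M by apply: le_trans (p0 0) _; have /andP[] := pM 0.
have y0 eta : 0 <= pairing phi eta by apply: pairing_ge0.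
have mp := measurable_pairing pc.
pose e n : R := n.+1%:R^-1.
have e0 n : 0 < e n by rewrite invr_gt0.
pose f n (eta : configB) := pairing phi eta / (1 + e n * pairing phi eta).
have den n eta : 0 < 1 + e n * pairing phi eta.
  by rewrite ltr_pwDl// mulr_ge0// ltW.
have mf n : measurable_fun [set: configB] (f n).
  rewrite (_ : f n = (fun z : R => z / (1 + e n * `|z|)) \o pairing phi); last first.
    by apply/funext => eta; rewrite /f /= ger0_norm.
  apply: measurableT_comp => //; apply: continuous_measurable_fun => z.
  have cN : 1 + e n * `|y| @[y --> z] --> 1 + e n * `|z|.
    exact: (cvgD (cvg_cst (1 : R)) (cvgM (cvg_cst (e n)) (@norm_continuous _ R^o z))).
  apply: cvgM; first exact: cvg_id.
  by apply: cvgV => //; rewrite gt_eqF// ltr_pwDl// mulr_ge0// ltW.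
have f0 n eta : 0 <= f n eta by rewrite divr_ge0// ltW.
have fnd eta m n : (m <= n)%N -> f m eta <= f n eta.
  move=> mn; rewrite /f ler_wpM2l// lef_pV2 ?posrE//.
  by rewrite lerD2l ler_wpM2r// lef_pV2 ?posrE// ler_nat.
have fcvg eta : f n eta @[n --> \oo] --> pairing phi eta.
  rewrite -[X in _ --> X]mulr1; apply: cvgM; first exact: cvg_cst.
  have den1 : 1 + e n * pairing phi eta @[n --> \oo] --> (1 : R).
    rewrite -[X in _ --> X]addr0 -[X in _ --> _ + X](mul0r (pairing phi eta)).
    exact: (cvgD (cvg_cst (1 : R)) (cvgM (@cvg_harmonic R) (cvg_cst _))).
  by rewrite -[X in _ --> X]invr1; apply: cvgV => //; exact: oner_neq0.
have cv : (\int[H t nu]_eta (f n eta)%:E)%E @[n --> \oo] -->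
    (\int[H t nu]_eta (pairing phi eta)%:E)%E.
  rewrite (_ : (\int[H t nu]_eta (pairing phi eta)%:E =
      \int[H t nu]_eta limn (fun n => (f n eta)%:E))%E); last first.
    apply: eq_integral => eta _; apply/esym/cvg_lim => //.
    by apply: cvg_EFin; [exact: nearW|exact: fcvg].
  apply: cvg_monotone_convergence => //.
  - by move=> n; apply/measurable_EFinP; exact: mf.
  - by move=> n eta _; rewrite lee_fin.
  - by move=> eta _ m n mn; rewrite lee_fin; exact: fnd.
rewrite -(cvg_lim _ cv)//; apply: lime_le; first by apply/cvg_ex; eexists; exact: cv.
apply: nearW => n; pose psi x := expR (- (e n * phi x)).
have psi01 x : 0 <= psi x <= 1.
  by apply: expRN_range; rewrite mulr_ge0// ltW.
have psic : continuous psi.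
  apply: (@continuous_expRN _ _ (fun x => e n * phi x)) => x.
  exact: (cvgM (cvg_cst (e n)) (pc x)).
have apsi := continuous_admissible psic psi01.
have hatE eta : hat psi eta = expR (- (e n * pairing phi eta)).
  by rewrite /psi hat_expRN /pairing mulr_sumr.
have h01 eta := hat_ge0_le1 eta psi01.
have mh := admissible_hat apsi.
apply: (@le_trans _ _ (\int[H t nu]_eta ((e n)^-1%:E * (1 - hat psi eta)%:E))%E).
  apply: ge0_le_integral_unmeasured => eta _; first by rewrite lee_fin.
  rewrite -EFinM lee_fin hatE mulrC ler_pdivlMr//.
  apply: le_trans (le_one_minus_expRN _); last by rewrite mulr_ge0// ltW.
  by rewrite /f mulrC mulrA.
have m1h : measurable_fun [set: configB] (fun eta => (1 - hat psi eta)%:E).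
  by apply/measurable_EFinP; apply: measurable_funB.
have h1 eta : (0 <= (1 - hat psi eta)%:E)%E.
  by rewrite lee_fin subr_ge0; have /andP[] := h01 eta.
rewrite ge0_integralZl//; last by rewrite lee_fin invr_ge0 ltW.
have I1 : (\int[H t nu]_eta (1 - hat psi eta)%:E = (1 - hat (flow t psi) nu)%:E)%E.
  have : (\int[H t nu]_eta ((1 - hat psi eta)%:E + (hat psi eta)%:E) = 1)%E.
    under eq_integral do rewrite -EFinD subrK.
    by rewrite integral_cst// mul1e prob_kernel.
  rewrite ge0_integralD//; last 2 first.
  - by move=> eta _; rewrite lee_fin; have /andP[] := h01 eta.
  - exact/measurable_EFinP.
  rewrite (integral_hat hB)// => I1.
  by rewrite EFinB -[1%:E]I1 addeK.
rewrite I1 -EFinM lee_fin mulrC ler_pdivrMr//.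
have -> : B * e n = (size (enum_mset nu))%:R * (e n * M * expR (b' * t)).
  by rewrite /B; ring.
apply: one_minus_hat_le => x; first exact: (flow_range hB).
have eM0 : 0 <= e n * M by rewrite mulr_ge0// ltW.
have [eM|eM] := leP (e n * M) 1; last first.
  have : 1 <= expR (b' * t).
    by rewrite -expR0 ler_expR mulr_ge0// ltW// (le_lt_trans b0).
  have /andP[? _] := flow_range hB x apsi t0.
  by move=> E1; have := ler_pM ler01 ler01 (ltW eM) E1; lra.
have eM01 : 0 <= e n * M <= 1 by rewrite eM0.
have := flow_cst_growth x bb' t0 eM01.
have : flow t (fun=> 1 - e n * M) x <= flow t psi x.
  apply: (le_flow hB) => // [|y]; first by apply: admissible_cst; lra.
  apply: le_trans (expR_ge1Dx _); rewrite lerD2l lerN2 ler_wpM2l ?(ltW (e0 n))//.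
  by have /andP[] := pM y.
lra.
Qed.

End mean_growth.

(** * The occupation time *)

Section one_time_law.
Context {R : realType} {d : nat}.
Local Notation rV := 'rV[R]_d.
Local Notation configB := (borel (config R d)).
Context {dO : measure_display} {Omega : measurableType dO}.
Variables (P : configB -> probability Omega R) (X : R -> Omega -> configB).
Variable H : R -> R.-pker configB ~> configB.
Hypothesis hM : markov_process P X H.

Lemma measurable_process_at t : 0 <= t -> measurable_fun [set: Omega] (X t).
Proof.
move=> t0.
have mt : measurable_fun [set: Omega]
    ((fun w => (t, w)) : Omega -> measurableTypeR R * Omega)%type.
  by apply: measurable_fun_pair => //.
apply: (measurable_comp (@measurable_ge0_times R _ Omega) _ (markov_measurable hM) mt).
by move=> _ [w _ <-].
Qed.

Lemma law_at mu t B : 0 <= t -> measurable B -> P mu (X t @^-1` B) = H t mu B.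
Proof.
move=> t0 mB.
have FT : natural_filtration X 0 setT.
  by apply: sub_gen_smallest; exists 0, setT; rewrite lexx.
have := markov_property hM mu (lexx 0) t0 FT mB.
rewrite setTI add0r => ->.
have mHB : measurable_fun [set: Omega] (fun w => H t (X 0 w) B).
  have := measurableT_comp (measurable_kernel (H t) B mB) (measurable_process_at (lexx 0)).
  exact.
transitivity (\int[P mu]_(w in setT) (fun=> H t mu B) w)%E; last first.
  by rewrite integral_cst//= [X in (_ * X)%E](probability_setT (P mu)) mule1.
apply: ae_eq_integral => //.
have [N [mN N0 sub]] := markov_start hM mu.
exists N; split => // w /= nw; apply: sub => /= Xw; apply: nw => _.
by rewrite Xw.
Qed.

Lemma expectation_at mu t (f : configB -> \bar R) : 0 <= t ->
    measurable_fun setT f -> (forall eta, 0 <= f eta)%E ->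
  (\int[P mu]_w f (X t w) = \int[H t mu]_eta f eta)%E.
Proof.
move=> t0 mf f0; have mX := measurable_process_at t0.
rewrite (eq_measure_integral (pushforward (P mu) (X t))); last first.
  by move=> A mA _; rewrite -(law_at mu t0 mA).
by rewrite ge0_integral_pushforward//.
Qed.

Variable phi : rV -> R.
Hypothesis phi_cont : continuous phi.

(** The paths are extended to negative times by their value at [0], for Tonelli's
theorem on the whole line. *)
Definition mass (p : measurableTypeR R * Omega) : R :=
  pairing phi (X (Num.max p.1 0) p.2).

Lemma measurable_mass : measurable_fun [set: measurableTypeR R * Omega] mass.
Proof.
apply: (measurable_comp (F := [set: configB])) => //.
  exact: measurable_pairing.
have mpos : measurable_fun [set: measurableTypeR R * Omega]
    ((fun p => (Num.max p.1 0, p.2)) :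
       measurableTypeR R * Omega -> measurableTypeR R * Omega)%type.
  apply: measurable_fun_pair => //.
  by apply: measurable_maxr => //; exact: measurable_fst.
apply: (measurable_comp (@measurable_ge0_times R _ Omega) _ (markov_measurable hM) mpos).
by move=> _ [p _ <-]; rewrite /= le_max lexx orbT.
Qed.

Lemma occupation_mass t w :
  occupation X phi t w = (\int[lebesgue_measure]_(s in `[0%R, t]) (mass (s, w))%:E)%E.
Proof.
apply: eq_integral => s; rewrite inE /= in_itv /= => /andP[s0 _].
by rewrite /mass /= max_l.
Qed.

Lemma tonelli_itv mu (D : set (measurableTypeR R))
    (F : measurableTypeR R * Omega -> R) :
    measurable D -> measurable_fun setT F -> (forall p, 0 <= F p) ->
  measurable_fun setT (fun w => \int[lebesgue_measure]_(s in D) (F (s, w))%:E)%E /\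
  (\int[P mu]_w \int[lebesgue_measure]_(s in D) (F (s, w))%:E =
   \int[lebesgue_measure]_(s in D) \int[P mu]_w (F (s, w))%:E)%E.
Proof.
move=> mD mF F0.
pose G (p : measurableTypeR R * Omega) : \bar R := (F p * \1_D p.1)%:E.
have mG : measurable_fun setT G.
  apply/measurable_EFinP; apply: measurable_funM => //.
  by apply: measurableT_comp => //; exact: measurable_indic.
have G0 p : (0 <= G p)%E by rewrite lee_fin mulr_ge0.
have GE w : (\int[lebesgue_measure]_(s in D) (F (s, w))%:E =
    \int[lebesgue_measure]_s G (s, w))%E.
  rewrite integral_mkcond; apply: eq_integral => s _.
  by rewrite /G patchE indicE /=; case: (s \in D); rewrite ?mulr1 ?mulr0.
have GE' : (\int[lebesgue_measure]_(s in D) \int[P mu]_w (F (s, w))%:E =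
    \int[lebesgue_measure]_s \int[P mu]_w G (s, w))%E.
  rewrite integral_mkcond; apply: eq_integral => s _; rewrite /G patchE.
  case: ifPn => sD.
    by apply: eq_integral => w _; rewrite indicE sD mulr1.
  by rewrite integral0_eq// => w _; rewrite indicE (negbTE sD) mulr0.
have Gfun : (fun w => \int[lebesgue_measure]_(s in D) (F (s, w))%:E)%E =
  (fun w => \int[lebesgue_measure]_s G (s, w))%E by apply/funext.
rewrite Gfun GE'; split.
  exact: (measurable_fun_fubini_tonelli_G (m1 := lebesgue_measure) G mG G0).
exact: esym (fubini_tonelli (m1 := lebesgue_measure) (m2 := P mu) G mG G0).
Qed.

End one_time_law.

(** Jensen's inequality, from the tangent line of the exponential at the mean
[m]. *)
Lemma expeRN_integral_le (R : realType) (D : set (measurableTypeR R))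
    (g : measurableTypeR R -> R) :
    measurable D -> lebesgue_measure D = 1%E ->
    measurable_fun setT g -> (forall s, 0 <= g s) ->
  (expeR (- \int[lebesgue_measure]_(s in D) (g s)%:E) <=
   \int[lebesgue_measure]_(s in D) (expR (- g s))%:E)%E.
Proof.
move=> mD D1 mg g0.
have I0 : (0 <= \int[lebesgue_measure]_(s in D) (g s)%:E)%E.
  by apply: integral_ge0 => s _; rewrite lee_fin.
have mgD : measurable_fun D (fun s => (g s)%:E).
  by apply/measurable_EFinP; exact: measurable_funTS.
have meD : measurable_fun D (fun s => (expR (- g s))%:E).
  apply/measurable_EFinP; apply: measurable_funTS.
  by apply: measurableT_comp => //; exact: measurableT_comp.
have E0 : (0 <= \int[lebesgue_measure]_(s in D) (expR (- g s))%:E)%E.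
  by apply: integral_ge0 => s _; rewrite lee_fin expR_ge0.
case mE : (\int[lebesgue_measure]_(s in D) (g s)%:E)%E I0 => [m| |]//= m0.
have : (\int[lebesgue_measure]_(s in D) (expR (- m) * (1 + m))%:E <=
    \int[lebesgue_measure]_(s in D)
      ((expR (- g s))%:E + (expR (- m))%:E * (g s)%:E))%E.
  apply: ge0_le_integral_unmeasured => s _.
    rewrite lee_fin mulr_ge0 ?expR_ge0//.
    by rewrite lee_fin in m0; lra.
  rewrite -EFinM -EFinD lee_fin.
  have -> : expR (- g s) = expR (- m) * expR (m - g s) by rewrite -expRD; congr expR; lra.
  rewrite -mulrDr ler_wpM2l ?expR_ge0//.
  have := expR_ge1Dx (m - g s); lra.
have f10 s : D s -> (0 <= (expR (- g s))%:E)%E by rewrite lee_fin expR_ge0.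
have g0D s : D s -> (0 <= (g s)%:E)%E by rewrite lee_fin.
have f20 s : D s -> (0 <= (expR (- m))%:E * (g s)%:E)%E.
  by rewrite -EFinM lee_fin mulr_ge0 ?expR_ge0.
have em0 : (0 <= (expR (- m))%:E)%E by rewrite lee_fin expR_ge0.
have mf2 : measurable_fun D (fun s => (expR (- m))%:E * (g s)%:E)%E.
  exact: measurable_funeM.
rewrite (ge0_integralD _ mD f10 meD f20 mf2) (ge0_integralZl _ mD mgD g0D em0).
rewrite mE integral_cst// [X in (_ * X)%E]D1 mule1 -EFinM mulrDr mulr1 EFinD.
by rewrite leeD2rE// => h; exact: h.
Qed.

Section occupation_time.
Context {R : realType} {d : nat}.
Local Notation rV := 'rV[R]_d.
Local Notation configB := (borel (config R d)).
Context {dO : measure_display} {Omega : measurableType dO}.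
Variables (P : configB -> probability Omega R) (X : R -> Omega -> configB).
Variables (q : nat -> R) (H : R -> R.-pker configB ~> configB).
Hypothesis hM : markov_process P X H.
Hypothesis hB : branching_transition q H.
Variable phi : rV -> R.
Hypothesis phi_cont : continuous phi.
Hypothesis phi_ge0 : forall x, 0 <= phi x.
Variable mu : configB.

Let mass_ge0 p : 0 <= mass X phi p.
Proof. exact: pairing_ge0. Qed.

Let measurable_mass_at w :
  measurable_fun [set: measurableTypeR R] (fun s => mass X phi (s, w)).
Proof.
have mp : measurable_fun [set: measurableTypeR R]
    ((fun s => (s, w)) : measurableTypeR R -> measurableTypeR R * Omega)%type.
  by apply: measurable_fun_pair.
exact: (measurableT_comp (measurable_mass hM phi_cont) mp).
Qed.

Lemma occupation_ge0 t w : (0 <= occupation X phi t w)%E.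
Proof.
by rewrite occupation_mass; apply: integral_ge0 => s _; rewrite lee_fin.
Qed.

Lemma expeRN_occupation_le1 (c : R) t w : 0 <= c ->
  (expeR (- (occupation X phi t w * c%:E)) <= 1)%E.
Proof.
move=> c0; rewrite -expeR0 lee_expeR oppe_le0 mule_ge0//; exact: occupation_ge0.
Qed.

(** The occupation time up to [t] is at least that of the unit interval starting
at [S], where Jensen's inequality and Tonelli's theorem leave the one-time
Laplace transforms of the process. *)
Lemma laplace_occupation_le (S t eps : R) : 0 <= S -> S + 1 <= t ->
    (forall s, S <= s -> hat (flow H s (fun x => expR (- phi x))) mu <= eps) ->
  (\int[P mu]_w expeR (- occupation X phi t w) <= eps%:E)%E.
Proof.
move=> S0 St small.
pose D : set (measurableTypeR R) := `[S, S + 1]%classic.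
have mD : measurable D by exact: measurable_itv.
have D1 : lebesgue_measure D = 1%E.
  by rewrite lebesgue_measure_itv/= lte_fin ltrDl ltr01 -EFinB addrAC subrr add0r.
pose F p := expR (- mass X phi p).
have mF : measurable_fun [set: measurableTypeR R * Omega] F.
  apply: measurableT_comp => //; apply: measurableT_comp => //.
  exact: (measurable_mass hM phi_cont).
have F0 p : 0 <= F p by exact: expR_ge0.
apply: (@le_trans _ _
    (\int[P mu]_w \int[lebesgue_measure]_(s in D) (F (s, w))%:E)%E).
  apply: ge0_le_integral_unmeasured => w _; first exact: expeR_ge0.
  apply: le_trans (expeRN_integral_le mD D1 (measurable_mass_at w) _); last first.
    by move=> s; exact: mass_ge0.
  have m0t : measurable (`[0, t]%classic : set (measurableTypeR R)).
    exact: measurable_itv.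
  rewrite lee_expeR leeN2 occupation_mass; apply: ge0_subset_integral => //.
  - by apply/measurable_EFinP; apply: measurable_funTS.
  - by move=> s _; rewrite lee_fin.
  - move=> s; rewrite /D /= !in_itv /= => /andP[s1 s2].
    by rewrite (le_trans S0 s1) (le_trans s2 St).
have [_ ->] := tonelli_itv P mu mD mF F0.
apply: (@le_trans _ _ (\int[lebesgue_measure]_(s in D) eps%:E)%E); last first.
  by rewrite integral_cst// [X in (_ * X)%E]D1 mule1.
apply: ge0_le_integral_unmeasured => s.
  by move=> _; apply: integral_ge0 => w _; rewrite lee_fin.
rewrite /D /= in_itv /= => /andP[Ss _]; have s0 := le_trans S0 Ss.
have psic := continuous_expRN phi_cont.
have psi01 x := expRN_range (phi_ge0 x).
have ap := continuous_admissible psic psi01.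
rewrite (_ : (\int[P mu]_w (F (s, w))%:E)%E =
    (hat (flow H s (fun x => expR (- phi x))) mu)%:E) ?lee_fin ?small//.
rewrite -(integral_hat hB)// -(expectation_at hM mu s0); last 2 first.
- by apply/measurable_EFinP; exact: admissible_hat.
- by move=> eta; rewrite lee_fin hat_expRN expR_ge0.
by apply: eq_integral => w _; rewrite hat_expRN /F /mass /= max_l.
Qed.

(** [1 - y <= exp (- y)] in the mean, and the mean of the occupation time is the
integral of the means. *)
Lemma laplace_occupation_ge (c B t : R) : 0 <= c -> 0 <= t -> 0 <= B ->
    (forall s, 0 <= s <= t ->
      (\int[H s mu]_eta (pairing phi eta)%:E <= B%:E)%E) ->
  ((1 - c * (B * t))%:E <=
   \int[P mu]_w expeR (- (occupation X phi t w * c%:E)))%E.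
Proof.
move=> c0 t0 B0 hBd; set E := (\int[P mu]_w _)%E.
pose D : set (measurableTypeR R) := `[0, t]%classic.
have mD : measurable D by exact: measurable_itv.
have [mo EO] := tonelli_itv P mu mD (measurable_mass hM phi_cont) mass_ge0.
have occE : occupation X phi t =
    (fun w => \int[lebesgue_measure]_(s in D) (mass X phi (s, w))%:E)%E.
  by apply/funext => w; exact: occupation_mass.
have muD : lebesgue_measure D = t%:E by exact: lebesgue_measure_itv0.
have Eocc : (\int[P mu]_w occupation X phi t w <= (B * t)%:E)%E.
  rewrite occE EO EFinM -[X in (_ * X)%E]muD -integral_cst//.
  apply: ge0_le_integral_unmeasured => s.
    by move=> _; apply: integral_ge0 => w _; rewrite lee_fin.
  rewrite /D /= in_itv /= => st; have /andP[s0 _] := st.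
  apply: le_trans (hBd s st); rewrite -(expectation_at hM mu s0).
  - by rewrite /mass /= max_l.
  - by apply/measurable_EFinP; exact: measurable_pairing.
  - by move=> eta; rewrite lee_fin pairing_ge0.
have mocc : measurable_fun setT (occupation X phi t) by rewrite occE.
have o0 w : (0 <= occupation X phi t w)%E := occupation_ge0 t w.
have moc : measurable_fun setT (fun w => occupation X phi t w * c%:E)%E.
  by apply: emeasurable_funM.
(* The positive part of [1 - y] lies below [exp (- y)] and is measurable also at
   infinite values of [y]. *)
pose f w := maxe (1 - occupation X phi t w * c%:E)%E 0%E.
have mf : measurable_fun setT f.
  by apply: measurable_maxe => //; apply: emeasurable_funB.
have f0 w : (0 <= f w)%E by rewrite /f le_max lexx orbT.
have oc0 w : (0 <= occupation X phi t w * c%:E)%E by rewrite mule_ge0.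
have fE : (\int[P mu]_w f w <= E)%E.
  apply: ge0_le_integral_unmeasured => w _ //; rewrite /f ge_max expeR_ge0 andbT.
  case: (_ * _)%E (oc0 w) => [r| |]//= r0.
  by rewrite lee_fin; have := expR_ge1Dx (- r); lra.
have : (1 <= E + \int[P mu]_w (occupation X phi t w * c%:E))%E.
  apply: le_trans (leeD fE (lexx _)); rewrite -ge0_integralD//.
  rewrite -[leLHS](probability_setT (P mu)) -[leLHS]mul1e -integral_cst//.
  apply: ge0_le_integral_unmeasured => w _; first exact: lee01.
  rewrite /f; case: (_ * _)%E (oc0 w) => [r| |]//= r0.
    rewrite -EFinB -EFin_max -EFinD lee_fin.
    have : 1 - r <= Num.max (1 - r) 0 by rewrite le_max lexx.
    lra.
  by rewrite maxNye add0e leey.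
rewrite ge0_integralZr// => h1.
rewrite EFinB leeBlDr//; apply: le_trans h1 _; rewrite leeD2l//.
by rewrite mulrC EFinM lee_wpmul2r// lee_fin.
Qed.

End occupation_time.

(** * Conclusion *)

Lemma exists_branching_rate (R : realType) (q : nat -> R) :
    (forall k, (1 <= k)%N -> 0 <= q k) ->
    (\sum_(1 <= k <oo) (q k)%:E = 1)%E ->
    (1 < \sum_(1 <= k <oo) (k%:R * q k)%:E)%E ->
  exists2 K, (2 <= K)%N & 0 < q K.
Proof.
move=> q_ge0 q_sum; apply: contraPP => none; apply/negP; rewrite -leNgt.
apply: series_le_of_partial_sums => [k k1|n]; first by rewrite mulr_ge0 ?q_ge0.
apply: le_trans (partial_sum_le1 q_ge0 q_sum n); apply: ler_sum_nat => k /andP[k1 _].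
case: k k1 => [//|[|k]] k1; first by rewrite mul1r.
suff -> : q k.+2 = 0 by rewrite mulr0.
apply/eqP; rewrite eq_le q_ge0// andbT leNgt; apply/negP => qk.
by apply: none; exists k.+2.
Qed.

Lemma hat_le_at (R : realType) (d : nat) (psi : 'rV[R]_d -> R) (nu : config R d) x :
    (forall y, 0 <= psi y <= 1) -> x \in enum_mset nu ->
  hat psi nu <= psi x.
Proof.
move=> p01 xnu; rewrite /hat (big_rem x)//=.
rewrite ler_piMr//; first by have /andP[] := p01 x.
by apply: prodr_ile1 => y _; exact: p01.
Qed.

Lemma exists_particle (R : realType) (d : nat) (nu : config R d) :
  nu != mset0 -> exists x, x \in enum_mset nu.
Proof.
case E : (enum_mset nu) => [|x s]; last by move=> _; exists x; rewrite mem_head.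
have -> : nu = mset0 by rewrite -[nu]seq_mset_id -[RHS]seq_mset_id E enum_mset0.
by rewrite eqxx.
Qed.

Lemma cvg_unit_interval (R : realType) (f : R -> \bar R) (l : R) :
    (forall t, 0 <= f t <= 1)%E ->
    (forall eps : R, 0 < eps -> exists T, forall t, T <= t ->
      ((l - eps)%:E <= f t <= (l + eps)%:E)%E) ->
  f t @[t --> +oo] --> l%:E.
Proof.
move=> f01 fl.
have fE t : f t = (fine (f t))%:E.
  rewrite fineK// ge0_fin_numE; last by have /andP[] := f01 t.
  by have /andP[_ /le_lt_trans] := f01 t; apply; exact: ltry.
have -> : f = EFin \o (fine \o f) by apply/funext => t; exact: fE.
apply: cvg_EFin; first exact: nearW.
apply/cvgrPdist_le => eps eps0; have [T hT] := fl eps eps0.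
near=> t; have : T <= t by near: t; apply: nbhs_pinfty_ge; exact: num_real.
move=> /hT; rewrite fE !lee_fin => /andP[h1 h2] /=.
by rewrite ler_norml; apply/andP; split; lra.
Unshelve. all: by end_near. Qed.

Lemma expR_ge_sqr (R : realType) (z : R) : 0 <= z -> z ^+ 2 / 4 <= expR z.
Proof.
move=> z0; have -> : z = z / 2 + z / 2 by lra.
rewrite expRD; have := expR_ge1Dx (z / 2) => h.
have h0 : 0 <= 1 + z / 2 by lra.
by have := ler_pM h0 h0 h h; rewrite expr2; nra.
Qed.

Theorem theorem4p3 (R : realType) (d : nat) (hd : (1 <= d)%N)
  (q : nat -> R)
  (q_ge0 : forall k, (1 <= k)%N -> 0 <= q k)
  (q_sum : (\sum_(1 <= k <oo) (q k)%:E = 1)%E)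
  (q_mean_gt1 : (1 < \sum_(1 <= k <oo) (k%:R * q k)%:E)%E)
  (q_mean_fin : (\sum_(1 <= k <oo) (k%:R * q k)%:E < +oo)%E)
  (q_moment2 : (\sum_(1 <= k <oo) (k%:R ^+ 2 * q k)%:E < +oo)%E)
  (dO : measure_display) (Omega : measurableType dO)
  (P : borel (config R d) -> probability Omega R)
  (X : R -> Omega -> borel (config R d))
  (H : R -> R.-pker (borel (config R d)) ~> (borel (config R d)))
  (hX : branching_process P X q H)
  (mu : borel (config R d))
  (phi : 'rV[R]_d -> R)
  (phi_cont : continuous phi)
  (phi_bound : exists M : R, forall x, `|phi x| <= M)
  (phi_ge0 : forall x, 0 <= phi x) :
  ((exists x, phi x != 0) -> mu != mset0 ->
     (\int[P mu]_w expeR (- occupation X phi t w))%E @[t --> +oo] --> 0%E)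
  /\
  (forall alpha : R, 0 < alpha ->
     alpha < (fine (\sum_(1 <= k <oo) ((k%:R - 1) * q k)%:E)%E)^-1 ->
     (\int[P mu]_w
        expeR (- (occupation X phi T w * ((expR (T / alpha))^-1)%:E)))%E
       @[T --> +oo] --> 1%E).
Proof.
have [hM _ hB] := hX; have hT := markov_transition hM.
have laplace01 (c t : R) : 0 <= c ->
    (0 <= \int[P mu]_w expeR (- (occupation X phi t w * c%:E)) <= 1)%E.
  move=> c0; apply/andP; split.
    by apply: integral_ge0 => w _; exact: expeR_ge0.
  rewrite -[leRHS](probability_setT (P mu)) -[leRHS]mul1e -integral_cst//.
  apply: ge0_le_integral_unmeasured => w _; first exact: expeR_ge0.
  exact: expeRN_occupation_le1.
split.
  move=> [x0 phi0] mu0; have [K K2 qK] := exists_branching_rate q_ge0 q_sum q_mean_gt1.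
  have [x xmu] := exists_particle mu0.
  apply: cvg_unit_interval => [t|eps eps0].
    by have := laplace01 1 t ler01; under eq_integral do rewrite mule1.
  pose psi y := expR (- phi y).
  have psic : continuous psi := continuous_expRN phi_cont.
  have psi01 y : 0 <= psi y <= 1 := expRN_range (phi_ge0 y).
  have psi1 : psi x0 < 1.
    by rewrite -expR0 ltr_expR oppr_lt0 lt_neqAle eq_sym phi0 phi_ge0.
  have ap := continuous_admissible psic psi01.
  have [S S0 hS] := hair_trigger_effect q_ge0 q_sum hT hB x K2 qK hd psic psi01 psi1 eps0.
  exists (S + 1) => t St; apply/andP; split.
    apply: (@le_trans _ _ 0%E); first by rewrite lee_fin; lra.
    by apply: integral_ge0 => w _; exact: expeR_ge0.
  rewrite add0r; apply: (laplace_occupation_le hM hB phi_cont phi_ge0 S0 St) => s Ss.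
  have s0 := le_trans S0 Ss.
  apply: le_trans (hS s Ss); apply: hat_le_at => // y.
  exact: (flow_range hB).
move=> alpha alpha0; set b := fine _ => alphab.
have binv0 : 0 < b^-1 by exact: lt_trans alphab.
have b0 : 0 < b by rewrite -invr_gt0.
have b_lt : b < alpha^-1.
  by rewrite -[b]invrK ltf_pV2 ?posrE.
(* Any rate strictly between [b] and [alpha^-1] would do. *)
pose b' := (b + alpha^-1) / 2; pose g := alpha^-1 - b'.
have g0 : 0 < g by rewrite /g /b'; lra.
have bb' : b < b' by rewrite /b'; lra.
have [M hM0] := phi_bound.
have phiM y : 0 <= phi y <= M by rewrite phi_ge0 (le_trans (ler_norm _)).
have M0 : 0 <= M by apply: le_trans (hM0 0).
pose N : R := (size (enum_mset mu))%:R.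
have N0 : 0 <= N by exact: ler0n.
apply: cvg_unit_interval => [t|eps eps0].
  by apply: laplace01; rewrite invr_ge0 expR_ge0.
exists (Num.max 1 (4 * (N * M) / (g ^+ 2 * eps))) => T.
rewrite ge_max => /andP[T1 TT]; have T0 : 0 < T by apply: lt_le_trans T1.
have c0 : 0 <= (expR (T / alpha))^-1 by rewrite invr_ge0 expR_ge0.
apply/andP; split; last first.
  apply: (@le_trans _ _ 1%E); first by have /andP[] := laplace01 _ T c0.
  by rewrite lee_fin; lra.
pose B := N * (M * expR (b' * T)).
have B0 : 0 <= B by rewrite !mulr_ge0 ?expR_ge0.
have bd s : 0 <= s <= T -> (\int[H s mu]_eta (pairing phi eta)%:E <= B%:E)%E.
  move=> /andP[s0 sT].
  apply: le_trans (mean_pairing_le q_ge0 q_sum q_mean_fin hT hB mu bb' s0 phi_cont phiM) _.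
  rewrite lee_fin ler_wpM2l// ler_wpM2l// ler_expR ler_wpM2l//.
  by rewrite ltW// (lt_trans b0).
apply: le_trans (laplace_occupation_ge hM phi_cont phi_ge0 c0 (ltW T0) B0 bd).
rewrite lee_fin lerD2l lerN2.
have -> : (expR (T / alpha))^-1 * (B * T) = N * M * (T * (expR (g * T))^-1).
  have -> : g * T = T / alpha - b' * T by rewrite /g; ring.
  by rewrite expRB /B; field; rewrite !gt_eqF ?expR_gt0.
have gT0 : 0 < g * T by rewrite mulr_gt0.
have gTe : T * (expR (g * T))^-1 <= 4 / (g ^+ 2 * T).
  rewrite ler_pdivlMr ?mulr_gt0 ?exprn_gt0// mulrAC ler_pdivrMr ?expR_gt0//.
  by have := expR_ge_sqr (ltW gT0); rewrite exprMn; lra.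
have NM0 : 0 <= N * M by rewrite mulr_ge0.
apply: le_trans (ler_wpM2l NM0 gTe) _.
rewrite mulrA ler_pdivrMr ?mulr_gt0 ?exprn_gt0//.
move: TT; rewrite ler_pdivrMr ?mulr_gt0 ?exprn_gt0//; lra.
Qed.
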